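(* Let $d\ge1$, $\delta>0$, and $N\ge d+2$. Let $\varphi_1,\dots,\varphi_N$ be i.i.d. random vectors uniformly distributed on $\mathbb{S}^{d-1}$, and $\epsilon_1,\dots,\epsilon_N$ i.i.d. uniform on $[-\delta,\delta]$, independent of the $\varphi_n$. Let $P_N=\bigcap_{n=1}^N\{u\in\mathbb{R}^d:|\langle u,\varphi_n\rangle-\epsilon_n|\le\delta\}$ and $W_N=\sup\{\|u\|:u\in P_N\}$. Then $$\mathbb{E}|W_N|^2\le\frac{2e^{12}\delta^2d^3}{(N+1)(N+2)}+26\delta^2d^{3/2}\Big(\frac{11}{12}\Big)^{N/2}e^{\frac{d\ln(1024d)}{2}}.$$ In particular, writing $W_N=W_N^{(d)}$ to indicate the dimension, $$\limsup_{d\to\infty}\mathbb{E}|W^{(d)}_{\lceil d^{3/2}\rceil}|^2\le2e^{12}\delta^2\qquad\text{and}\qquad\lim_{d\to\infty}\mathbb{E}|W^{(d)}_{\lceil d^{3/2}\ln d\rceil}|^2=0.$$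
   Context: $\mathbb{S}^{d-1}$ is the unit sphere of $\mathbb{R}^d$ with normalized surface measure. $W_N$ is the worst case error of consistent reconstruction from measurements $q_n=\langle x,\varphi_n\rangle+\epsilon_n$. *)

(* Defs.v *)
From HB Require Import structures.
From mathcomp Require Import all_boot all_order all_algebra.
From mathcomp Require Import all_classical all_reals all_analysis.
Set Implicit Arguments. Unset Strict Implicit. Unset Printing Implicit Defensive.
Import Order.TTheory GRing.Theory Num.Theory.
Import numFieldNormedType.Exports.
Local Open Scope classical_set_scope.
Local Open Scope ring_scope.

Definition dotp (R : realType) (d : nat) (u v : 'rV[R]_d) : R :=
  \sum_(i < d) u ord0 i * v ord0 i.
Definition enorm (R : realType) (d : nat) (u : 'rV[R]_d) : R :=
  Num.sqrt (dotp u u).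

Definition rV_borel (R : realType) (d : nat) : set (set 'rV[R]_d) :=
  <<s [set A : set 'rV[R]_d | open A] >>.

(* d-dimensional Lebesgue measure, defined by iterated 1-dim Lebesgue
   integrals (Tonelli); points are encoded as nat -> R (first n coords). *)
Definition ncons (R : realType) (x : R) (y : nat -> R) : nat -> R :=
  fun k => if k is k'.+1 then y k' else x.
Fixpoint vol (R : realType) (n : nat) (E : set (nat -> R)) : \bar R :=
  match n with
  | 0 => if `[< E (fun _ => 0) >] then 1%E else 0%E
  | n'.+1 => (\int[@lebesgue_measure R]_x vol n' [set y | E (ncons x y)])%E
  end.
Definition lvol (R : realType) (d : nat) (A : set 'rV[R]_d) : \bar R :=
  vol d [set f | A (\row_(i < d) f (nat_of_ord i))].

(* normalized surface measure on S^{d-1} (cone measure):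
   sigma(B) = vol{t x : 0 < t <= 1, x in B, |x| = 1} / vol(unit ball) *)
Definition unit_sphere (R : realType) (d : nat) : set 'rV[R]_d :=
  [set x | enorm x = 1].
Definition sphere_cone (R : realType) (d : nat) (B : set 'rV[R]_d) : set 'rV[R]_d :=
  [set u | exists t x, [/\ 0 < t <= 1, B x, enorm x = 1 & u = t *: x]].
Definition sphere_measure (R : realType) (d : nat) (B : set 'rV[R]_d) : \bar R :=
  (lvol (sphere_cone B) * ((fine (lvol [set u : 'rV[R]_d | enorm u <= 1]))^-1)%:E)%E.

Definition event_family (R : realType) (dsp : measure_display) (T : measurableType dsp)
  (d N : nat) (phi : 'I_N -> T -> 'rV[R]_d) (eps : 'I_N -> T -> R)
  (i : ('I_N + 'I_N)%type) : set (set T) :=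
  match i with
  | inl n => [set A | exists2 B, rV_borel B & A = phi n @^-1` B]
  | inr n => [set A | exists2 B, measurable B & A = eps n @^-1` B]
  end.

Definition model (R : realType) (dsp : measure_display) (T : measurableType dsp)
  (P : probability T R) (d N : nat) (delta : R)
  (phi : 'I_N -> T -> 'rV[R]_d) (eps : 'I_N -> T -> R) : Prop :=
  [/\
      (forall n B, rV_borel B -> measurable (phi n @^-1` B)),
      (forall n, measurable_fun setT (eps n)),
      (forall (J : {set ('I_N + 'I_N)%type}) (A : ('I_N + 'I_N)%type -> set T),
          (forall i, i \in J -> event_family phi eps i (A i)) ->
          P [set w | forall i, i \in J -> A i w] = (\prod_(i in J) P (A i))%E),
      (forall n B, rV_borel B -> P (phi n @^-1` B) = sphere_measure B) &
      (forall n B, measurable B ->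
          P (eps n @^-1` B) =
          (lebesgue_measure (B `&` [set x | (- delta <= x <= delta)%R])
            * ((2 * delta)^-1)%:E)%E)].

Definition PN (R : realType) (dsp : measure_display) (T : measurableType dsp)
  (d N : nat) (delta : R) (phi : 'I_N -> T -> 'rV[R]_d) (eps : 'I_N -> T -> R)
  (w : T) : set 'rV[R]_d :=
  [set u | forall n : 'I_N, `|dotp u (phi n w) - eps n w| <= delta].
Definition WN (R : realType) (dsp : measure_display) (T : measurableType dsp)
  (d N : nat) (delta : R) (phi : 'I_N -> T -> 'rV[R]_d) (eps : 'I_N -> T -> R)
  (w : T) : \bar R :=
  ereal_sup [set (enorm u)%:E | u in PN delta phi eps w].
Definition EW2 (R : realType) (dsp : measure_display) (T : measurableType dsp)
  (P : probability T R) (d N : nat) (delta : R)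
  (phi : 'I_N -> T -> 'rV[R]_d) (eps : 'I_N -> T -> R) : \bar R :=
  (\int[P]_w (`| WN delta phi eps w | ^+ 2))%E.

(* Main.v *)
(** Rotation invariance of iterated Lebesgue integrals (a plane rotation is a
product of shears) reduces the volume of a slab of the unit ball to that of
lower dimensional balls, whence [P(|<u, phi>| <= s) <= (6/5) s sqrt d / |u|].
If [|WN| > s], then by convexity [PN] contains some [u] with [|u| = s], and it
remains to bound this event by a union bound over a lattice.

For [s = 16 a delta sqrt d] with [a <= 1], only the noises within [a delta] of an
endpoint of [[- delta, delta]] matter: each makes the constraint on [u] essentially
one-sided. Greedy coordinatewise rounding of [u] keeps the quadratic error over
these constraints small, so the resulting lattice point satisfies all but a small
proportion of them, and an exponential moment bound gives
[P(|WN| > s) <= (515 e)^d (1 - 48 a / 125)^N]. For larger [s = r delta], all the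
constraints say [|<u, phi_n>| <= 2 delta], and the slab estimate gives a bound of
order [(c r)^d (C sqrt d / r)^N / r]; the last factor comes from the many lattice
points near the segment from [7u/8] to [u].

Summing over the dyadic radii [2^k s] with [s = 500 delta d^(3/2) / (N + 2)], the
first regime yields the polynomial term and the second the exponential one. *)
Require Import Defs.
From HB Require Import structures.
From mathcomp Require Import all_boot all_order all_algebra.
From mathcomp Require Import all_classical all_reals all_analysis.
From mathcomp Require Import measurable_realfun ring lra zify.
Set Implicit Arguments. Unset Strict Implicit. Unset Printing Implicit Defensive.
Import Order.TTheory GRing.Theory Num.Theory.
Import numFieldNormedType.Exports HBNNSimple.
Local Open Scope classical_set_scope.
Local Open Scope ring_scope.

(** * Volumes of slabs of the unit ball *)

(** Measurability is the first obstacle: neither [WN] nor the slices of arbitrary sets in [vol] come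
    with it. A nonnegative integral is a supremum over simple functions below the integrand, hence
    monotone for arbitrary functions. Tail probabilities are replaced by integrals of explicit
    measurable majorants, built from finite sums of products of indicators; expanding such a product
    gives indicators of cylinder events, to which the independence of events in [model] applies
    directly.

    Lattice points are weighted rather than counted: exp(d - |z|_1 / k) is at least 1 at the points
    z that matter, and its sum factors over the coordinates.

    The number 500 in the first radius s is constrained from both sides. The radius s and the first
    regime together cost 6/5 s^2, and 6/5 * 500^2 <= 2 e^12. On the other hand, at a = s / (16 delta
    sqrt d) the rate 48/125 gives the exponent 48/125 a N = 12 d N / (N + 2), which must beat the
    entropy (515 e)^d <= e^(8 d). *)

Lemma ge0_le_integral_nonmeas d (T : measurableType d) (R : realType)
    (mu : {measure set T -> \bar R}) (f g : T -> \bar R) :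
  (forall x, 0 <= f x)%E -> (forall x, f x <= g x)%E ->
  (\int[mu]_x f x <= \int[mu]_x g x)%E.
Proof.
move=> f0 fg.
have g0 x : (0 <= g x)%E by exact: le_trans (fg x).
rewrite !ge0_integralTE//; apply: ereal_sup_le => _ [h /= hf <-].
by exists h => // x; exact: le_trans (fg x).
Qed.

Lemma ge0_integral_shift (R : realType) (f : R -> \bar R) (a : R) :
  measurable_fun setT f -> (forall x, 0 <= f x)%E ->
  (\int[@lebesgue_measure R]_x f (x + a)%R = \int[@lebesgue_measure R]_x f x)%E.
Proof.
move=> mf f0.
have mphi : measurable_fun setT (fun x : measurableTypeR R => x + a : measurableTypeR R).
  by apply: measurable_funD => //; exact: measurable_cst.
pose phi : {mfun measurableTypeR R >-> measurableTypeR R} :=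
  HB.pack (fun x : measurableTypeR R => x + a : measurableTypeR R)
    (isMeasurableFun.Build _ _ _ _ _ mphi).
have /= <- := @ge0_integral_pushforward _ _ _ _ R _ mphi lebesgue_measure setT f measurableT mf (fun x _ => f0 x).
apply: eq_measure_integral => /= A mA _.
apply/esym.
apply: (@lebesgue_measure_unique R (pushforward lebesgue_measure phi)) => // _ [[x y]] _ <-.
transitivity (@lebesgue_measure R `](x - a), (y - a)]%classic); last first.
  rewrite /pushforward /=; congr lebesgue_measure.
  by apply/seteqP; split => z /=; rewrite !in_itv/= ltrBlDr lerBrDr.
rewrite !lebesgue_measure_itv/= !lte_fin ltrD2r.
by case: ifP => // _; rewrite -!EFinB; congr EFin; ring.
Qed.

Lemma ge0_integral_dilation (R : realType) (f : R -> \bar R) (c : R) :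
  0 < c -> measurable_fun setT f -> (forall x, 0 <= f x)%E ->
  (\int[@lebesgue_measure R]_x f x =
   c%:E * \int[@lebesgue_measure R]_x f (c * x)%R)%E.
Proof.
move=> c0 mf f0.
have mphi : measurable_fun setT (fun x : measurableTypeR R => c * x : measurableTypeR R).
  by apply: measurable_funM => //; exact: measurable_cst.
pose phi : {mfun measurableTypeR R >-> measurableTypeR R} :=
  HB.pack (fun x : measurableTypeR R => c * x : measurableTypeR R)
    (isMeasurableFun.Build _ _ _ _ _ mphi).
have /= <- := @ge0_integral_pushforward _ _ _ _ R _ mphi lebesgue_measure setT f measurableT mf (fun x _ => f0 x).
have c0' := ltW c0.
rewrite -(@ge0_integral_mscale _ _ R (pushforward lebesgue_measure phi) setT
  measurableT (NngNum c0') f)//.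
apply: eq_measure_integral => /= A mA _.
apply: (@lebesgue_measure_unique R
  (mscale (NngNum c0') (pushforward lebesgue_measure phi))) => // _ [[x y]] _ <-.
transitivity (c%:E * @lebesgue_measure R `](x / c)%R, (y / c)%R]%classic)%E; last first.
  rewrite /mscale /pushforward /=; congr (_ * lebesgue_measure _)%E.
  by apply/seteqP; split => z /=; rewrite !in_itv/= ltr_pdivrMr// ler_pdivlMr// ![z * _]mulrC.
rewrite !lebesgue_measure_itv/= !lte_fin ltr_pM2r ?invr_gt0//.
case: ifPn => xy; last by rewrite mule0.
by rewrite -EFinB -EFinM -mulrBl mulrC divfK// gt_eqF.
Qed.

Lemma ge0_integral_swap {R : realType} {G : R * R -> \bar R} :
  measurable_fun setT G -> (forall p, 0 <= G p)%E ->
  (\int[@lebesgue_measure R]_x \int[@lebesgue_measure R]_y G (x, y) =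
   \int[@lebesgue_measure R]_y \int[@lebesgue_measure R]_x G (x, y))%E.
Proof.
move=> mG G0.
exact: (@fubini_tonelli _ _ (measurableTypeR R) (measurableTypeR R) R lebesgue_measure lebesgue_measure G).
Qed.

Lemma integral_shear2 (R : realType) (G : R * R -> \bar R) (s : R) :
  measurable_fun setT G -> (forall p, 0 <= G p)%E ->
  (\int[@lebesgue_measure R]_x \int[@lebesgue_measure R]_y G (x, y + s * x)%R =
   \int[@lebesgue_measure R]_x \int[@lebesgue_measure R]_y G (x, y))%E.
Proof.
move=> mG G0; apply: eq_integral => x _.
apply: (@ge0_integral_shift R (fun y => G (x, y))) => // .
exact: (measurableT_comp mG (@pair1_measurable _ _ (measurableTypeR R) (measurableTypeR R) x)).
Qed.

Lemma measurable_fun_lin2 (R : realType) (a b : R) :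
  measurable_fun setT (fun p : R * R => a * p.1 + b * p.2).
Proof.
by apply: measurable_funD; apply: measurable_funM => //; exact: measurable_cst.
Qed.

Lemma measurable_comp_lin2 (R : realType) (G : R * R -> \bar R) (a b c d : R) :
  measurable_fun setT G ->
  measurable_fun setT
    (fun p : R * R => G (a * p.1 + b * p.2, c * p.1 + d * p.2)).
Proof.
move=> mG; apply: (measurableT_comp mG).
by apply: measurable_fun_pair; exact: measurable_fun_lin2.
Qed.

Lemma integral_shear1 (R : realType) (G : R * R -> \bar R) (s : R) :
  measurable_fun setT G -> (forall p, 0 <= G p)%E ->
  (\int[@lebesgue_measure R]_x \int[@lebesgue_measure R]_y G (x + s * y, y)%R =
   \int[@lebesgue_measure R]_x \int[@lebesgue_measure R]_y G (x, y))%E.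
Proof.
move=> mG G0.
have mS : measurable_fun setT (fun p : R * R => G (p.1 + s * p.2, p.2)).
  have := @measurable_comp_lin2 R G 1 s 0 1 mG.
  by congr measurable_fun; apply/funext => -[x y] /=; rewrite !mul1r mul0r add0r.
apply: etrans; first exact: (ge0_integral_swap mS (fun=> G0 _)).
apply: etrans; last exact: (esym (ge0_integral_swap mG G0)).
apply: eq_integral => y _ /=.
apply: (@ge0_integral_shift R (fun x => G (x, y))) => // .
exact: (measurableT_comp mG (@pair2_measurable _ _ (measurableTypeR R) (measurableTypeR R) y)).
Qed.

(* A plane rotation is the product of three shears, with parameters
   [- tan (theta / 2)], [sin theta] and [- tan (theta / 2)]. *)
Lemma integral_rotation (R : realType) (G : R * R -> \bar R) (c s : R) :
  c ^+ 2 + s ^+ 2 = 1 -> s != 0 ->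
  measurable_fun setT G -> (forall p, 0 <= G p)%E ->
  (\int[@lebesgue_measure R]_x \int[@lebesgue_measure R]_y
     G (c * x - s * y, s * x + c * y)%R =
   \int[@lebesgue_measure R]_x \int[@lebesgue_measure R]_y G (x, y))%E.
Proof.
move=> cs s0 mG G0; pose t := (1 - c) / s.
have mG1 : measurable_fun setT (fun p : R * R => G (p.1 - t * p.2, p.2)).
  have := @measurable_comp_lin2 R G 1 (- t) 0 1 mG.
  by congr measurable_fun; apply/funext => -[x y] /=; rewrite !mul1r mulNr mul0r add0r.
have mG2 : measurable_fun setT
    (fun p : R * R => G (p.1 - t * (p.2 + s * p.1), p.2 + s * p.1)).
  have := @measurable_comp_lin2 R _ 1 0 s 1 mG1.
  congr measurable_fun; apply/funext => -[x y] /=.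
  by rewrite !mul1r mul0r addr0 (addrC (s * x)).
have ts : t * s = 1 - c by rewrite /t divfK.
have tc : t * (1 + c) = s.
  by rewrite /t mulrAC -(subr_sqr 1 c) expr1n -cs addrAC subrr add0r expr2 mulfK.
transitivity (\int[@lebesgue_measure R]_x \int[@lebesgue_measure R]_y
   (fun p : R * R => G (p.1 - t * (p.2 + s * p.1), p.2 + s * p.1)%R)
     ((x + (- t) * y)%R, y))%E.
  apply: eq_integral => x _; apply: eq_integral => y _ /=; congr G; congr pair.
    transitivity ((1 - t * s) * x - (t * (1 + (1 - t * s))) * y); last by ring.
    by rewrite ts subKr tc.
  transitivity (s * x + (1 - t * s) * y); last by ring.
  by rewrite ts subKr.
apply: etrans;
  first exact: (@integral_shear1 R _ (- t) mG2 (fun=> G0 _)).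
apply: etrans;
  first exact: (@integral_shear2 R _ s mG1 (fun=> G0 _)).
apply: etrans; last exact: (@integral_shear1 R G (- t) mG G0).
by apply: eq_integral => x _; apply: eq_integral => y _; rewrite mulNr.
Qed.

(** * Iterated volumes, balls and their slices *)

Lemma vol_ge0 (R : realType) n (E : set (nat -> R)) : (0 <= vol n E)%E.
Proof.
elim: n E => [|n IH] E /=; first by case: ifP.
by apply: integral_ge0 => x _; exact: IH.
Qed.

Lemma volS (R : realType) n (E : set (nat -> R)) :
  vol n.+1 E = (\int[@lebesgue_measure R]_x vol n [set y | E (Defs.ncons x y)])%E.
Proof. by []. Qed.

Lemma vol_le (R : realType) n (E F : set (nat -> R)) :
  E `<=` F -> (vol n E <= vol n F)%E.
Proof.
elim: n E F => [|n IH] E F EF /=.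
  case: ifPn => [/asboolP E0|_]; last by case: ifP.
  by rewrite ifT//; apply/asboolP/EF.
apply: ge0_le_integral_nonmeas => x; first exact: vol_ge0.
by apply: IH => y /= /EF.
Qed.

Lemma vol_set0 (R : realType) n : vol n (@set0 (nat -> R)) = 0%E.
Proof.
elim: n => [|n IH] /=; first by rewrite ifF//; apply/asboolPn.
by apply: integral0_eq => x _; rewrite -[RHS]IH; congr vol; apply/seteqP.
Qed.

Lemma vol_setI_cst (R : realType) n (E : set (nat -> R)) (Q : Prop) :
  vol n [set y | E y /\ Q] = ((\1_[set _ : R | Q] 0)%:E * vol n E)%E.
Proof.
rewrite indicE; have [q|q] := pselect Q.
  rewrite mem_set// mul1e; congr vol; apply/seteqP; split => y /=; tauto.
rewrite memNset// mul0e -(vol_set0 R n); congr vol.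
by apply/seteqP; split => y //= [_ /q].
Qed.

(** Parametrized by the squared radius, so that slicing at [x] merely replaces [c] by [c - x ^+ 2],
    and a negative [c] gives the empty ball. *)
Definition ball_vol (R : realType) (n : nat) (c : R) : \bar R :=
  vol n [set y : nat -> R | \sum_(i < n) y i ^+ 2 <= c].

Lemma ball_vol_ge0 (R : realType) n (c : R) : (0 <= @ball_vol R n c)%E.
Proof. exact: vol_ge0. Qed.

Lemma le_ball_vol (R : realType) n (b c : R) :
  b <= c -> (@ball_vol R n b <= @ball_vol R n c)%E.
Proof. by move=> bc; apply: vol_le => y /= /le_trans; exact. Qed.

Lemma ball_vol0 (R : realType) (c : R) :
  @ball_vol R 0 c = (\1_`[0, +oo[ c)%:E.
Proof.
rewrite /ball_vol /= indicE mem_setE in_itv/= andbT.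
have -> : `[< [set y : nat -> R | \sum_(i < 0) y i ^+ 2 <= c] (fun _ => 0) >] = (0 <= c).
  by apply/asboolP/idP => /=; rewrite big_ord0.
by case: ifP.
Qed.

Lemma ball_volS (R : realType) n (c : R) :
  @ball_vol R n.+1 c = (\int[@lebesgue_measure R]_x @ball_vol R n (c - x ^+ 2)%R)%E.
Proof.
apply: eq_integral => x _; congr vol; apply/seteqP.
by split => y /=; rewrite big_ord_recl /= lerBrDl.
Qed.

Lemma measurable_ball_vol (R : realType) n :
  measurable_fun [set: R] (@ball_vol R n).
Proof.
elim: n => [|n IH].
  have -> : @ball_vol R 0 = (fun c => (\1_`[0, +oo[ c)%:E).
    by apply/funext => c; exact: ball_vol0.
  exact/measurable_EFinP/measurable_indic.
have -> : @ball_vol R n.+1 = fubini_F (@lebesgue_measure R)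
    (fun p : R * measurableTypeR R => @ball_vol R n (p.1 - p.2 ^+ 2)).
  by apply/funext => c; rewrite ball_volS.
apply: measurable_fun_fubini_tonelli_F => [|p]; last exact: ball_vol_ge0.
apply: (measurableT_comp IH); apply: measurable_funB => //.
exact: measurable_funX.
Qed.

Lemma ball_vol_dilation (R : realType) n (s c : R) : 0 < s ->
  @ball_vol R n (s ^+ 2 * c) = ((s ^+ n)%:E * @ball_vol R n c)%E.
Proof.
move=> s0; elim: n c => [|n IH] c.
  rewrite expr0 mul1e !ball_vol0 !indicE !mem_setE !in_itv/= !andbT.
  by rewrite pmulr_rge0// exprn_gt0.
have mf b : measurable_fun [set: R] (fun x => @ball_vol R n (b - x ^+ 2)).
  apply: (measurableT_comp (@measurable_ball_vol R n)); apply: measurable_funB => //.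
rewrite !ball_volS (@ge0_integral_dilation R _ s)//; last first.
  by move=> x; exact: ball_vol_ge0.
under eq_integral => x _ do rewrite exprMn -mulrBr IH.
rewrite ge0_integralZl//; last 3 first.
- exact: mf.
- by move=> x _; exact: ball_vol_ge0.
- by rewrite lee_fin exprn_ge0// ltW.
by rewrite muleA -EFinM -exprS.
Qed.

Lemma ball_vol_lt0 (R : realType) n (c : R) : c < 0 -> @ball_vol R n c = 0%E.
Proof.
move=> c0; rewrite -[RHS](vol_set0 R n); congr vol; apply/seteqP; split => y //= yc.
have : 0 <= c by apply: le_trans yc; apply: sumr_ge0 => i _; exact: sqr_ge0.
by rewrite leNgt c0.
Qed.

(** The cube of side 2 contains the ball. This crude bound serves only to make the volume finite. *)
Lemma ball_vol_le (R : realType) n (c : R) :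
  c <= 1 -> (@ball_vol R n c <= (2 ^+ n)%:E)%E.
Proof.
elim: n c => [|n IH] c c1.
  by rewrite ball_vol0 expr0 lee_fin indicE; case: (_ \in _).
rewrite ball_volS.
apply: (@le_trans _ _ (\int[@lebesgue_measure R]_x ((2 ^+ n)%:E * (\1_`[-1, 1] x)%:E))%E).
  apply: ge0_le_integral_nonmeas => x; first exact: ball_vol_ge0.
  have [x1|x1] := boolP (x \in `[-1, 1]).
    rewrite indicE mem_setE x1 mule1; apply: IH.
    by rewrite lerBlDr ler_wpDr// sqr_ge0.
  rewrite ball_vol_lt0 ?mule_ge0 ?lee_fin//.
  rewrite subr_lt0; apply: (le_lt_trans c1).
  rewrite in_itv/= -ler_norml -ltNge in x1.
  by rewrite -(real_normK (num_real x)) expr_gt1.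
rewrite ge0_integralZl//; last first.
  by apply/measurable_EFinP; exact: measurable_indic.
rewrite integral_indic// setIT.
rewrite /= lebesgue_measure_itv/= lte_fin ifT; last lra.
by rewrite -EFinB -EFinM lee_fin exprS; lra.
Qed.

(** The left side is the harmonic mean of 1 and 1 - y, the right side their geometric mean. *)
Lemma onem_sqrt_ge (R : realType) (y : R) :
  0 <= y <= 1 -> 1 - y / (2 - y) <= Num.sqrt (1 - y).
Proof.
move=> /andP[y0 y1]; have y2 : 0 < 2 - y by lra.
have h : 0 <= 1 - y / (2 - y).
  by rewrite subr_ge0 ler_pdivrMr//; lra.
rewrite -(ler_pXn2r (n := 2)) ?nnegrE ?sqrtr_ge0// sqr_sqrtr ?subr_ge0//.
rewrite -subr_ge0.
have -> : 1 - y - (1 - y / (2 - y)) ^+ 2 = (1 - y) * y ^+ 2 / (2 - y) ^+ 2.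
  by field; lra.
by rewrite divr_ge0 ?sqr_ge0// mulr_ge0 ?sqr_ge0// subr_ge0.
Qed.

Lemma Bernoulli_ge (R : realType) (x : R) n :
  x <= 1 -> 1 - n%:R * x <= (1 - x) ^+ n.
Proof.
move=> x1; elim: n => [|n IH]; first by rewrite mul0r subr0 expr0.
rewrite exprS; apply: (@le_trans _ _ ((1 - x) * (1 - n%:R * x))); last first.
  by rewrite ler_wpM2l// subr_ge0.
rewrite -natr1 -subr_ge0.
have -> : (1 - x) * (1 - n%:R * x) - (1 - (n%:R + 1) * x) = n%:R * x ^+ 2 by ring.
by rewrite mulr_ge0 ?ler0n// sqr_ge0.
Qed.

(** Bernoulli applied to [onem_sqrt_ge] gives the slope n / (2 - y) with y = x^2, at most (n + 1) /
    2 in the given range. The slope n / 2 would already fail for n = 1, by concavity of the square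
    root. *)
Lemma sqrt_onem_expn_ge (R : realType) (n : nat) (x : R) :
  x ^+ 2 * n.+1%:R <= 1 -> 1 - n.+1%:R / 2 * x ^+ 2 <= Num.sqrt (1 - x ^+ 2) ^+ n.
Proof.
set y := x ^+ 2 => yn1; have y0 : 0 <= y by exact: sqr_ge0.
have n0 : 0 <= n%:R :> R by exact: ler0n.
rewrite -natr1 in yn1 *.
have y1 : y <= 1 by nra.
have y2 : 0 < 2 - y by lra.
have h1 := @onem_sqrt_ge R y; rewrite y0 y1 in h1; have {}h1 := h1 isT.
have z1 : y / (2 - y) <= 1 by rewrite ler_pdivrMr//; lra.
apply: (@le_trans _ _ ((1 - y / (2 - y)) ^+ n)); last first.
  by rewrite lerXn2r// nnegrE ?sqrtr_ge0// subr_ge0.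
apply: le_trans (Bernoulli_ge n z1).
rewrite lerD2l lerN2 mulrA ler_pdivrMr//.
by nra.
Qed.

Lemma integral_parabola (R : realType) (a : R) : 0 < a ->
  (\int[@lebesgue_measure R]_(x in `[(- a)%R, a]%classic) (1 - x ^+ 2 / (2 * a ^+ 2))%:E
   = (5 / 3 * a)%:E)%E.
Proof.
move=> a0.
pose F (x : R) := x - x ^+ 3 / (6 * a ^+ 2).
have dF (x : R) : is_derive x 1 F (1 - x ^+ 2 / (2 * a ^+ 2)).
  apply: is_derive_eq; rewrite /GRing.scale /=.
  by field; lra.
rewrite (@continuous_FTC2 R _ F); last 4 first.
- lra.
- apply: continuous_subspaceT => x.
  apply: cvgB; first exact: cvg_cst.
  apply: cvgM; last exact: cvg_cst.
  exact: exprn_continuous.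
- split.
  + by move=> x _; exact: ex_derive.
  + apply: cvg_at_right_filter; apply: differentiable_continuous.
    by apply/derivable1_diffP; exact: ex_derive.
  + apply: cvg_at_left_filter; apply: differentiable_continuous.
    by apply/derivable1_diffP; exact: ex_derive.
- by move=> x _; rewrite derive1E derive_val.
by rewrite -EFinB /F; congr EFin; field; lra.
Qed.

(** Only the slices with |x| <= a = 1 / sqrt (n + 1) are kept. There the slice volume is at least 1
    - x^2 / (2 a^2) times that of the n-dimensional unit ball, and this parabola integrates to 5 a /
    3. *)
Lemma ball_volS_ge (R : realType) n :
  ((5 / (3 * Num.sqrt n.+1%:R))%:E * @ball_vol R n 1 <= @ball_vol R n.+1 1)%E.
Proof.
pose m : R := n.+1%:R; have m0 : 0 < m by rewrite ltr0n.
pose a := (Num.sqrt m)^-1; have a0 : 0 < a by rewrite invr_gt0 sqrtr_gt0.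
have a2 : a ^+ 2 = m^-1 by rewrite /a exprVn sqr_sqrtr// ltW.
have -> : 5 / (3 * Num.sqrt n.+1%:R) = 5 / 3 * a.
  by rewrite /a invfM mulrA.
have parab_ge0 x : `|x| <= a -> 0 <= 1 - x ^+ 2 / (2 * a ^+ 2).
  move=> xa; rewrite subr_ge0 ler_pdivrMr; last by rewrite mulr_gt0// exprn_gt0.
  rewrite mul1r (le_trans (y := a ^+ 2))//; last by have := sqr_ge0 a; lra.
  by rewrite -(real_normK (num_real x)) lerXn2r// nnegrE ltW.
rewrite -integral_parabola// -ge0_integralZr//; last 3 first.
- apply/measurable_EFinP; apply: measurable_funB => //.
  by apply: measurable_funM => //; exact: measurable_funX.
- by move=> x; rewrite /= in_itv/= -ler_norml => /parab_ge0; rewrite lee_fin.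
- exact: ball_vol_ge0.
rewrite integral_mkcond ball_volS.
apply: ge0_le_integral_nonmeas => x.
  rewrite patchE; case: ifPn => //; rewrite inE/= in_itv/= -ler_norml => xa.
  by rewrite mule_ge0 ?ball_vol_ge0// lee_fin parab_ge0.
rewrite patchE; case: ifPn => [|_]; last exact: ball_vol_ge0.
rewrite inE/= in_itv/= -ler_norml => xa.
have xm : x ^+ 2 * m <= 1.
  rewrite -ler_pdivlMr// mul1r -a2 -(real_normK (num_real x)).
  by rewrite lerXn2r// nnegrE ltW.
have m1 : 1 <= m by rewrite ler1n.
have x1 : x ^+ 2 <= 1 by have := sqr_ge0 x; nra.
have parabE : 1 - x ^+ 2 / (2 * a ^+ 2) = 1 - m / 2 * x ^+ 2.
  by rewrite a2; field; lra.
(* A slice of radius 0 escapes [ball_vol_dilation], which needs a positive factor; within |x| <= a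
   it occurs only for [n = 0]. *)
have [x2|x2] := eqVneq (x ^+ 2) 1.
  have n0 : n = 0%N.
    by move: xm; rewrite x2 mul1r lern1 ltnS leqn0 => /eqP.
  rewrite {}n0 in m m0 a a0 a2 parab_ge0 xa xm m1 parabE *.
  rewrite !ball_vol0 x2 !indicE !mem_setE !in_itv/= subrr lexx ler01/= mule1.
  by rewrite lee_fin a2 /m invr1; lra.
have {}x2 : x ^+ 2 < 1 by rewrite lt_neqAle x2.
have s0 : 0 < Num.sqrt (1 - x ^+ 2) by rewrite sqrtr_gt0 subr_gt0.
have -> : ball_vol n (1 - x ^+ 2) = ball_vol n (Num.sqrt (1 - x ^+ 2) ^+ 2 * 1).
  by rewrite mulr1 sqr_sqrtr// subr_ge0.
rewrite ball_vol_dilation//; apply: lee_wpmul2r; first exact: ball_vol_ge0.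
by rewrite lee_fin parabE; exact: sqrt_onem_expn_ge.
Qed.

Lemma ball_vol_gt0 (R : realType) n : (0 < @ball_vol R n 1)%E.
Proof.
elim: n => [|n IH].
  by rewrite ball_vol0 indicE mem_setE in_itv/= ler01 lte_fin.
apply: lt_le_trans (ball_volS_ge R n); apply: mule_gt0 => //.
Qed.

Lemma ball_vol_fin (R : realType) n : @ball_vol R n 1 \is a fin_num.
Proof.
rewrite ge0_fin_numE ?ball_vol_ge0//.
by apply: le_lt_trans (ball_vol_le n (lexx 1)) _; rewrite ltry.
Qed.

(** The rotation with cosine a / alpha and sine b / alpha preserves x^2 + y^2 and aligns the linear
    form with the first axis. For [b = 0] no rotation is made, since the three shears require a
    nonzero sine; [alpha] is then [a], of either sign. *)
Lemma integral_circular_strip (R : realType) (a b : R) :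
  exists2 alpha : R, alpha ^+ 2 = a ^+ 2 + b ^+ 2 &
  forall F : R * R -> \bar R, measurable_fun [set: R * R] F ->
    (forall p, 0 <= F p)%E ->
  (\int[@lebesgue_measure R]_x \int[@lebesgue_measure R]_y
     F (x ^+ 2 + y ^+ 2, a * x + b * y)%R =
   \int[@lebesgue_measure R]_x \int[@lebesgue_measure R]_y
     F (x ^+ 2 + y ^+ 2, alpha * x)%R)%E.
Proof.
have [b0|b0] := eqVneq b 0.
  exists a; first by rewrite b0 expr0n addr0.
  by move=> F _ _; apply: eq_integral => x _; apply: eq_integral => y _; rewrite b0 mul0r addr0.
have ab0 : 0 < a ^+ 2 + b ^+ 2.
  by rewrite ltr_wpDl ?sqr_ge0// exprn_even_gt0.
exists (Num.sqrt (a ^+ 2 + b ^+ 2)); first by rewrite sqr_sqrtr// ltW.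
set al := Num.sqrt _; have al0 : 0 < al by rewrite sqrtr_gt0.
have al2 : al ^+ 2 = a ^+ 2 + b ^+ 2 by rewrite sqr_sqrtr// ltW.
move=> F mF F0; pose c := a / al; pose s := b / al.
have cs : c ^+ 2 + s ^+ 2 = 1.
  by rewrite !exprMn -mulrDl exprVn al2 divff// gt_eqF.
have s0 : s != 0 by rewrite mulf_neq0// invr_eq0 gt_eqF.
have mG : measurable_fun [set: R * R]
    (fun p : R * R => F (p.1 ^+ 2 + p.2 ^+ 2, a * p.1 + b * p.2)).
  apply: (measurableT_comp mF); apply: measurable_fun_pair.
    by apply: measurable_funD; exact: measurable_funX.
  exact: measurable_fun_lin2.
apply: etrans; first exact: (esym (integral_rotation cs s0 mG (fun=> F0 _))).
apply: eq_integral => x _; apply: eq_integral => y _ /=; congr F; congr pair.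
  have -> : (c * x - s * y) ^+ 2 + (s * x + c * y) ^+ 2 = (c ^+ 2 + s ^+ 2) * (x ^+ 2 + y ^+ 2) by ring.
  by rewrite cs mul1r.
have -> : a = al * c by rewrite /c mulrC divfK// gt_eqF.
have -> : b = al * s by rewrite /s mulrC divfK// gt_eqF.
rewrite -[RHS]mulr1 -cs; ring.
Qed.

(** Induction on the dimension: after fixing the first coordinate, the induction hypothesis reduces
    the remaining linear form to one variable, and a plane rotation merges that variable with the
    first. The offset [b] absorbs the term of the fixed coordinate, and [alpha] must precede [c],
    [b], [s] because the hypothesis is applied under the integral, where these vary. *)
Lemma vol_ball_slab (R : realType) n (u : nat -> R) :
  exists2 alpha : R, alpha ^+ 2 = \sum_(i < n.+1) u i ^+ 2 &
  forall c b s : R,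
  vol n.+1 [set y : nat -> R | \sum_(i < n.+1) y i ^+ 2 <= c /\
     `|\sum_(i < n.+1) u i * y i + b| <= s] =
  (\int[@lebesgue_measure R]_x
     ((\1_[set l | `|l| <= s] (alpha * x + b)%R)%:E * ball_vol n (c - x ^+ 2)%R))%E.
Proof.
elim: n u => [|n IH] u.
  exists (u 0); first by rewrite big_ord1.
  move=> c b s; rewrite volS; apply: eq_integral => x _.
  transitivity (vol 0 [set y : nat -> R | (\sum_(i < 0) y i ^+ 2 <= c - x ^+ 2) /\
      `|u 0 * x + b| <= s]).
    congr vol; apply/seteqP.
    by split=> y /=; rewrite big_ord0 !big_ord1 /= subr_ge0.
  by rewrite vol_setI_cst !indicE.
have [al' al'E IHal] := IH (fun i => u i.+1).
have [al alE rot] := @integral_circular_strip R (u 0) al'.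
exists al; first by rewrite alE al'E [RHS]big_ord_recl.
move=> c b s.
pose F (p : R * R) := ((\1_[set l | `|l| <= s] (p.2 + b)%R)%:E * ball_vol n (c - p.1)%R)%E.
have mF : measurable_fun [set: R * R] F.
  apply: emeasurable_funM.
    apply/measurable_EFinP; apply: measurableT_comp; last exact: measurable_funD.
    apply: measurable_indic.
    have -> : [set l : R | `|l| <= s] = `[- s, s]%classic.
      by apply/seteqP; split => x /=; rewrite in_itv/= ler_norml.
    exact: measurable_itv.
  have mg : measurable_fun [set: R * R] (fun p : R * R => c - p.1) by exact: measurable_funB.
  exact: (measurableT_comp (@measurable_ball_vol R n) mg).
have F0 p : (0 <= F p)%E by rewrite mule_ge0 ?ball_vol_ge0// lee_fin.
transitivity (\int[@lebesgue_measure R]_x \int[@lebesgue_measure R]_y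
     F (x ^+ 2 + y ^+ 2, u 0%N * x + al' * y)%R)%E.
  rewrite volS; apply: eq_integral => x _.
  transitivity (vol n.+1 [set y : nat -> R | \sum_(i < n.+1) y i ^+ 2 <= c - x ^+ 2 /\
     `|\sum_(i < n.+1) u i.+1 * y i + (u 0 * x + b)| <= s]).
    congr vol; apply/seteqP.
    by split=> y /=; rewrite !(big_ord_recl n.+1) /= lerBrDl addrCA addrA.
  rewrite IHal; apply: eq_integral => y _; rewrite /F /=.
  by congr ((\1__ _)%:E * ball_vol n _)%E; ring.
rewrite rot//; apply: eq_integral => x _.
rewrite ball_volS -ge0_integralZl//; last 2 first.
- apply: (measurableT_comp (@measurable_ball_vol R n)); apply: measurable_funB => //; exact: measurable_funX.
- by move=> y _; exact: ball_vol_ge0.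
apply: eq_integral => y _; rewrite /F /= opprD addrA.
by [].
Qed.

(** * Euclidean norm and the measure of spherical slabs *)

Lemma dotp_ge0 (R : realType) d (u : 'rV[R]_d) : 0 <= dotp u u.
Proof. by apply: sumr_ge0 => i _; rewrite -expr2 sqr_ge0. Qed.

Lemma enorm_ge0 (R : realType) d (u : 'rV[R]_d) : 0 <= enorm u.
Proof. exact: sqrtr_ge0. Qed.

Lemma enorm_sqr (R : realType) d (u : 'rV[R]_d) : enorm u ^+ 2 = dotp u u.
Proof. by rewrite sqr_sqrtr// dotp_ge0. Qed.

Lemma dotpZr (R : realType) d (u v : 'rV[R]_d) (t : R) :
  dotp u (t *: v) = t * dotp u v.
Proof. by rewrite mulr_sumr; apply: eq_bigr => i _; rewrite !mxE mulrCA. Qed.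

Lemma dotpZl (R : realType) d (u v : 'rV[R]_d) (t : R) :
  dotp (t *: u) v = t * dotp u v.
Proof. by rewrite mulr_sumr; apply: eq_bigr => i _; rewrite !mxE mulrA. Qed.

Lemma enormZ (R : realType) d (u : 'rV[R]_d) (t : R) :
  enorm (t *: u) = `|t| * enorm u.
Proof.
by rewrite /enorm dotpZl dotpZr mulrA -expr2 sqrtrM ?sqr_ge0// sqrtr_sqr.
Qed.

Lemma enorm_le1 (R : realType) d (u : 'rV[R]_d) : (enorm u <= 1) = (dotp u u <= 1).
Proof. by rewrite -enorm_sqr expr_le1// enorm_ge0. Qed.

Lemma dotp_row (R : realType) n (u : 'rV[R]_n.+1) (y : nat -> R) :
  dotp u (\row_i y i) = \sum_(i < n.+1) u ord0 (inord i) * y i.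
Proof. by apply: eq_bigr => i _; rewrite mxE inord_val. Qed.

Lemma dotp_rowrow (R : realType) n (y : nat -> R) :
  dotp (\row_(i < n) y i) (\row_(i < n) y i) = \sum_(i < n) y i ^+ 2.
Proof. by apply: eq_bigr => i _; rewrite mxE -expr2. Qed.

Lemma lvol_ball (R : realType) d :
  lvol [set u : 'rV[R]_d | enorm u <= 1] = ball_vol d 1.
Proof.
by congr vol; apply/seteqP; split => y /=; rewrite enorm_le1 dotp_rowrow.
Qed.

Lemma lvol_ball_slab (R : realType) n (u : 'rV[R]_n.+1) (s : R) :
  0 < enorm u -> 0 <= s ->
  (lvol [set x : 'rV[R]_n.+1 | (enorm x <= 1)%R /\ (`|dotp u x| <= s)%R] <=
   (2 * s / enorm u)%:E * ball_vol n 1)%E.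
Proof.
move=> u0 s0.
have [al alE slab] := vol_ball_slab n (fun i => u ord0 (inord i)).
have alu : `|al| = enorm u.
  apply/eqP; rewrite -(eqrXn2 (n := 2)) ?enorm_ge0// enorm_sqr real_normK ?num_real//.
  by rewrite alE; apply/eqP; apply: eq_bigr => i _; rewrite inord_val -expr2.
have al0 : 0 < `|al| by rewrite alu.
have -> : lvol [set x : 'rV[R]_n.+1 | (enorm x <= 1)%R /\ (`|dotp u x| <= s)%R] =
  vol n.+1 [set y : nat -> R | \sum_(i < n.+1) y i ^+ 2 <= 1 /\
     `|\sum_(i < n.+1) u ord0 (inord i) * y i + 0| <= s].
  by congr vol; apply/seteqP; split => y /=; rewrite enorm_le1 dotp_rowrow dotp_row addr0.
rewrite slab.
apply: (@le_trans _ _ (\int[@lebesgue_measure R]_x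
    ((\1_`[(- (s / `|al|))%R, s / `|al|]%classic x)%:E * ball_vol n 1))%E).
  apply: ge0_le_integral_nonmeas => x.
    by rewrite mule_ge0 ?ball_vol_ge0// lee_fin.
  apply: lee_pmul; rewrite ?ball_vol_ge0 ?lee_fin//; last first.
    by apply: le_ball_vol; have := sqr_ge0 x; lra.
  rewrite !indicE addr0 ler_nat.
  case: (boolP (_ \in _)) => // /set_mem /= h.
  by rewrite mem_set//= in_itv/= -ler_norml ler_pdivlMr// mulrC -normrM.
rewrite ge0_integralZr//; last 2 first.
- by apply/measurable_EFinP; exact: measurable_indic.
- exact: ball_vol_ge0.
apply: lee_wpmul2r; first exact: ball_vol_ge0.
rewrite integral_indic//= setIT lebesgue_measure_itv/= lte_fin alu.
have sal : 0 <= s / enorm u by rewrite divr_ge0// ltW.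
case: ifPn => _; last by rewrite lee_fin -mulrA mulr_ge0.
by rewrite -EFinB lee_fin; lra.
Qed.

(** Shrinking a point keeps it in a slab around the origin, so the cone over a spherical slab lies
    in the slab of the ball, of volume at most 2 s / |u| times that of the ball one dimension down.
    The ratio of the two ball volumes is at most 3/5 sqrt (n + 1), whence 6/5. *)
Lemma sphere_measure_slab (R : realType) n (u : 'rV[R]_n.+1) (s : R) :
  0 < enorm u -> 0 <= s ->
  (sphere_measure [set x | (`|dotp u x| <= s)%R] <=
   (6 / 5 * s * Num.sqrt n.+1%:R / enorm u)%:E)%E.
Proof.
move=> u0 s0; rewrite /sphere_measure lvol_ball.
have h1 : (lvol (sphere_cone [set x | (`|dotp u x| <= s)%R]) <=
   (2 * s / enorm u)%:E * ball_vol n 1)%E.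
  apply: le_trans (lvol_ball_slab u0 s0); apply: vol_le => y /=.
  move=> [t [x [/andP[t0 t1] xs x1 ->]]].
  rewrite enormZ x1 mulr1 gtr0_norm//; split => //.
  rewrite dotpZr normrM gtr0_norm//; apply: le_trans xs.
  by rewrite ler_piMl.
have := ball_volS_ge R n; have := @ball_vol_gt0 R n.+1; have := @ball_vol_gt0 R n.
rewrite -(fineK (ball_vol_fin R n)) -(fineK (ball_vol_fin R n.+1)) in h1 *.
move: (fine _) (fine (ball_vol n.+1 1)) h1 => a b h1; rewrite !lte_fin => a0 b0.
have q0 : 0 < Num.sqrt (n.+1%:R : R) by rewrite sqrtr_gt0 ltr0n.
rewrite -EFinM lee_fin => ab.
apply: (@le_trans _ _ ((2 * s / enorm u * a)%:E * (b^-1)%:E)%E).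
  by apply: lee_wpmul2r; rewrite ?lee_fin ?invr_ge0 ?(ltW b0)// EFinM.
rewrite -EFinM lee_fin.
have ab' : a / b <= 3 / 5 * Num.sqrt n.+1%:R.
  rewrite ler_pdivrMr//; set q := Num.sqrt _ in q0 ab *.
  have q35 : 0 <= 3 / 5 * q by rewrite mulr_ge0// ltW.
  apply: le_trans (ler_wpM2l q35 ab).
  by rewrite le_eqVlt; apply/orP; left; apply/eqP; field; lra.
have -> : 6 / 5 * s * Num.sqrt n.+1%:R / enorm u = 2 * s / enorm u * (3 / 5 * Num.sqrt n.+1%:R).
  by field; lra.
have k0 : 0 <= 2 * s / enorm u by rewrite divr_ge0 ?(ltW u0)// mulr_ge0.
by rewrite -[X in X <= _]mulrA ler_wpM2l.
Qed.

Lemma sphere_measure_off (R : realType) d (B : set 'rV[R]_d) :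
  (forall x, B x -> enorm x != 1) -> sphere_measure B = 0%E.
Proof.
move=> B1; rewrite /sphere_measure (_ : sphere_cone B = set0) /lvol; last first.
  by apply/seteqP; split => y //= [t [x [_ /B1 /eqP]]].
by rewrite (_ : [set f | _] = set0) ?vol_set0 ?mul0e//; apply/seteqP.
Qed.

(** * Independence and exponential moments *)

Lemma big_sumType_in (R : Type) (idx : R) (op : Monoid.com_law idx)
    (I J : finType) (F : I + J -> R) :
  \big[op/idx]_(i in [set: I + J]%SET) F i =
  op (\big[op/idx]_i F (inl i)) (\big[op/idx]_j F (inr j)).
Proof.
rewrite (eq_bigl xpredT); first exact: big_sumType.
by move=> i; rewrite finset.in_setT.
Qed.

Lemma prodEFin (R : realType) (I : finType) (f : I -> R) :
  (\prod_(i : I) (f i)%:E = (\prod_(i : I) f i)%:E)%E.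
Proof. by elim/big_rec2 : _ => // i x y _ ->; rewrite EFinM. Qed.

Lemma model_prob_cylinder (R : realType) dsp (T : measurableType dsp)
    (P : probability T R) d N delta (phi : 'I_N -> T -> 'rV[R]_d)
    (eps : 'I_N -> T -> R) (A : 'I_N -> set 'rV[R]_d) (I : 'I_N -> set R) :
  model P delta phi eps ->
  (forall n, rV_borel (A n)) -> (forall n, measurable (I n)) ->
  let E := [set w | forall n, A n (phi n w) /\ I n (eps n w)] in
  measurable E /\
  P E = (\prod_n (fine (P (phi n @^-1` A n)) * fine (P (eps n @^-1` I n))))%:E.
Proof.
move=> [mphi meps ind _ _] mA mI E.
have mp n : measurable (phi n @^-1` A n) by exact: mphi.
have me n : measurable (eps n @^-1` I n).
  by have := meps n measurableT _ (mI n); rewrite setTI.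
split.
  have -> : E = \bigcap_(n in [set: 'I_N]) ((phi n @^-1` A n) `&` (eps n @^-1` I n)).
    apply/seteqP; split => w /= h; first by move=> n _; exact: h.
    by move=> n; exact: (h n Logic.I).
  by apply: fin_bigcap_measurable => [|n _]; [exact: finite_finset|exact: measurableI].
pose Ev (i : ('I_N + 'I_N)%type) : set T :=
  match i with inl n => phi n @^-1` A n | inr n => eps n @^-1` I n end.
have -> : E = [set w | forall i, i \in [set: 'I_N + 'I_N]%SET -> Ev i w].
  apply/seteqP; split => w /= h; first by case=> n _; have [] := h n.
  by move=> n; split; [apply: (h (inl n))|apply: (h (inr n))]; rewrite finset.in_setT.
rewrite ind; last first.
  by case=> n _; [exists (A n)|exists (I n)].
rewrite big_sumType_in /=.
rewrite big_split /= EFinM -!prodEFin.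
by congr (_ * _)%E; apply: eq_bigr => n _; rewrite fineK// fin_num_measure.
Qed.

(** Distributing the product over the sums gives a sum over functions from ['I_N] to [J], each term
    being a constant times the indicator of one cylinder event. After [model_prob_cylinder] the sum
    is folded back into a product. *)
Lemma model_expectation_prod (R : realType) dsp (T : measurableType dsp)
    (P : probability T R) d N delta (phi : 'I_N -> T -> 'rV[R]_d)
    (eps : 'I_N -> T -> R) (J : finType) (c : J -> R)
    (A : J -> set 'rV[R]_d) (I : J -> set R) :
  model P delta phi eps -> (forall a, 0 <= c a) ->
  (forall a, rV_borel (A a)) -> (forall a, measurable (I a)) ->
  let g w := \prod_(n < N) \sum_a c a * (\1_(A a) (phi n w) * \1_(I a) (eps n w)) in
  measurable_fun setT g /\
  (\int[P]_w (g w)%:E = (\prod_(n < N) \sum_a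
      c a * (fine (P (phi n @^-1` A a)) * fine (P (eps n @^-1` I a))))%:E)%E.
Proof.
move=> mod c0 mA mI g.
pose E (f : {ffun 'I_N -> J}) :=
  [set w | forall n, A (f n) (phi n w) /\ I (f n) (eps n w)].
have EP (f : {ffun 'I_N -> J}) := model_prob_cylinder mod (fun n => mA (f n)) (fun n => mI (f n)).
have gE w : g w = \sum_(f : {ffun 'I_N -> J}) (\prod_n c (f n)) * \1_(E f) w.
  rewrite /g bigA_distr_bigA /=; apply: eq_bigr => f _.
  rewrite big_split /=; congr (_ * _); rewrite indicE.
  have [/set_mem Ew|Ew] := boolP (w \in E f).
    apply: big1 => n _; have [a1 a2] := Ew n.
    by rewrite !indicE !mem_set// mulr1.
  have [n nE] : exists n, ~ (A (f n) (phi n w) /\ I (f n) (eps n w)).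
    by apply/existsNP => h; move/negP: Ew; apply; apply/mem_set.
  rewrite (bigD1 n)//= !indicE.
  by move/not_andP : nE => [na|ni]; rewrite ?(memNset na) ?(memNset ni) ?mulr0 !mul0r.
have mE (f : {ffun 'I_N -> J}) : measurable_fun setT (fun w => (\prod_n c (f n)) * \1_(E f) w : R).
  apply: measurable_funM => //; apply: measurable_indic.
  by have [] := EP f.
split.
  rewrite (_ : g = fun w => \sum_(f : {ffun 'I_N -> J}) (\prod_n c (f n)) * \1_(E f) w); last exact/funext.
  exact: measurable_sum.
under eq_integral => w _ do rewrite gE -sumEFin.
rewrite ge0_integral_sum//; last 2 first.
- by move=> f; exact/measurable_EFinP.
- move=> f w _; rewrite lee_fin mulr_ge0// ?prodr_ge0// => n _; exact: c0.
rewrite bigA_distr_bigA /= -sumEFin; apply: eq_bigr => f _.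
have [mEf PE] := EP f.
under eq_integral => w _ do rewrite EFinM.
rewrite ge0_integralZl//; last 2 first.
- by apply/measurable_EFinP; exact: measurable_indic.
- by rewrite lee_fin prodr_ge0.
rewrite integral_indic// setIT.
by rewrite [X in (_ * X)%E]PE -EFinM [in RHS]big_split.
Qed.

(** * Borel sets of directions and the law of a single measurement *)

Lemma continuous_sumr (R : realType) (T : topologicalType) (I : finType)
    (f : I -> T -> R) :
  (forall i, continuous (f i)) -> continuous (fun x => \sum_i f i x).
Proof.
move=> cf; apply: continuous_big => //; exact: add_continuous.
Qed.

Lemma continuous_dotpl (R : realType) d (v : 'rV[R]_d) : continuous (dotp v).
Proof.
apply: continuous_sumr => i x.
exact: (cvgM (@cvg_cst _ (v ord0 i) _ _ _) (@coord_continuous R 1 d ord0 i x)).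
Qed.

Lemma continuous_dotp_diag (R : realType) d :
  continuous (fun x : 'rV[R]_d => dotp x x).
Proof.
apply: continuous_sumr => i x.
exact: (cvgM (@coord_continuous R 1 d ord0 i x) (@coord_continuous R 1 d ord0 i x)).
Qed.

Lemma rV_borel_open (R : realType) d (f : 'rV[R]_d -> R) (U : set R) :
  continuous f -> open U -> rV_borel (f @^-1` U).
Proof.
move=> cf oU; apply: sub_gen_smallest; rewrite /=.
by apply: open_comp => // x _; exact: cf.
Qed.

Lemma rV_borelC (R : realType) d (A : set 'rV[R]_d) :
  rV_borel A -> rV_borel (~` A).
Proof.
move=> mA; rewrite -setTD.
have [_ hC _] := smallest_sigma_algebra setT [set A : set 'rV[R]_d | open A].
exact: hC.
Qed.

Lemma rV_borel_dotp_lt (R : realType) d (v : 'rV[R]_d) (c : R) :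
  rV_borel [set x | dotp v x < c].
Proof.
apply: (@rV_borel_open R d (dotp v) [set y | y < c]); first exact: continuous_dotpl.
exact: open_lt.
Qed.

Lemma rV_borel_slab (R : realType) d (v : 'rV[R]_d) (s : R) :
  rV_borel [set x | `|dotp v x| <= s].
Proof.
have -> : [set x | `|dotp v x| <= s] = ~` (dotp v @^-1` [set y : R | s < `|y|]).
  by apply/seteqP; split => x /=; rewrite leNgt => /negP.
apply: rV_borelC; apply: (@rV_borel_open R d (dotp v) [set y : R | s < `|y|]).
  exact: continuous_dotpl.
apply: (@open_comp _ _ (fun y : R => `|y|) [set y : R | s < y]); last exact: open_gt.
by move=> y _; exact: norm_continuous.
Qed.

Lemma rV_borel_off_sphere (R : realType) d :
  rV_borel [set x : 'rV[R]_d | enorm x != 1].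
Proof.
have -> : [set x : 'rV[R]_d | enorm x != 1] = (fun x => dotp x x) @^-1` (~` [set 1]).
  by apply/seteqP; split => x /=; rewrite -enorm_sqr -(sqrp_eq1 (enorm_ge0 x)) => /eqP.
apply: (@rV_borel_open R d (fun x => dotp x x)); first exact: continuous_dotp_diag.
by apply: closed_openC; exact: closed_eq.
Qed.

Lemma model_phi_slab (R : realType) dsp (T : measurableType dsp)
    (P : probability T R) d N delta (phi : 'I_N -> T -> 'rV[R]_d)
    (eps : 'I_N -> T -> R) (v : 'rV[R]_d) (s : R) n :
  model P delta phi eps -> (0 < d)%N -> 0 < enorm v -> 0 <= s ->
  fine (P (phi n @^-1` [set x | `|dotp v x| <= s])) <=
    6 / 5 * s * Num.sqrt d%:R / enorm v.
Proof.
case: d phi v => // d phi v [mphi _ _ sm _] _ v0 s0.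
rewrite -lee_fin fineK; last first.
  by rewrite fin_num_measure//; apply: mphi; exact: rV_borel_slab.
by rewrite sm; [exact: sphere_measure_slab|exact: rV_borel_slab].
Qed.

Lemma model_phi_off_sphere (R : realType) dsp (T : measurableType dsp)
    (P : probability T R) d N delta (phi : 'I_N -> T -> 'rV[R]_d)
    (eps : 'I_N -> T -> R) n :
  model P delta phi eps ->
  P (phi n @^-1` [set x | enorm x != 1]) = 0%E.
Proof.
move=> [_ _ _ sm _]; rewrite sm; last exact: rV_borel_off_sphere.
exact: sphere_measure_off.
Qed.

Lemma model_eps_off (R : realType) dsp (T : measurableType dsp)
    (P : probability T R) d N delta (phi : 'I_N -> T -> 'rV[R]_d)
    (eps : 'I_N -> T -> R) n :
  model P delta phi eps ->
  P (eps n @^-1` (~` `[- delta, delta])) = 0%E.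
Proof.
move=> [_ _ _ _ em]; rewrite em; last exact: measurableC.
rewrite (_ : _ `&` _ = set0) ?measure0 ?mul0e//.
by apply/seteqP; split => x //= []; rewrite in_itv.
Qed.

Lemma model_eps_left (R : realType) dsp (T : measurableType dsp)
    (P : probability T R) d N delta (phi : 'I_N -> T -> 'rV[R]_d)
    (eps : 'I_N -> T -> R) n a :
  model P delta phi eps -> 0 < delta -> 0 <= a <= 2 ->
  fine (P (eps n @^-1` `[- delta, - delta + a * delta[)) = a / 2.
Proof.
move=> [_ _ _ _ em] d0 /andP[a0 a2]; rewrite em; last exact: measurable_itv.
have ad : 0 <= a * delta <= 2 * delta by apply/andP; split; nra.
rewrite (_ : _ `&` _ = `[- delta, - delta + a * delta[%classic); last first.
  apply/seteqP; split => x /=; rewrite in_itv/=; first by case.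
  by move=> /andP[x1 x2]; split; lra.
rewrite lebesgue_measure_itv/= lte_fin; case: ifPn => h.
  by rewrite -EFinB -EFinM /=; field; lra.
by rewrite mul0e /=; nra.
Qed.

Lemma model_eps_right (R : realType) dsp (T : measurableType dsp)
    (P : probability T R) d N delta (phi : 'I_N -> T -> 'rV[R]_d)
    (eps : 'I_N -> T -> R) n a :
  model P delta phi eps -> 0 < delta -> 0 <= a <= 2 ->
  fine (P (eps n @^-1` `]delta - a * delta, delta])) = a / 2.
Proof.
move=> [_ _ _ _ em] d0 /andP[a0 a2]; rewrite em; last exact: measurable_itv.
have ad : 0 <= a * delta <= 2 * delta by apply/andP; split; nra.
rewrite (_ : _ `&` _ = `]delta - a * delta, delta]%classic); last first.
  apply/seteqP; split => x /=; rewrite in_itv/=; first by case.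
  by move=> /andP[x1 x2]; split; lra.
rewrite lebesgue_measure_itv/= lte_fin; case: ifPn => h.
  by rewrite -EFinB -EFinM /=; field; lra.
by rewrite mul0e /=; nra.
Qed.

(** * Lattice points and rounding *)

Lemma sum_geometric_le (R : realType) (x : R) n :
  0 <= x < 1 -> \sum_(j < n) x ^+ j <= (1 - x)^-1.
Proof.
move=> /andP[x0 x1]; rewrite -[leRHS]mul1r ler_pdivlMr ?subr_gt0//.
have -> : (\sum_(j < n) x ^+ j) * (1 - x) = 1 - x ^+ n.
  by rewrite -[RHS]opprB subrX1 -mulNr opprB mulrC.
by rewrite lerBlDr lerDl exprn_ge0.
Qed.

(** Two geometric series of ratio x = exp(-1/k) on either side of the centre, each with x / (1 - x)
    = 1 / (exp(1/k) - 1) <= k, and 1 for the centre itself. The bound does not depend on [L]. *)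
Lemma sum_expR_dist_le (R : realType) (k : R) (L : nat) : 0 < k ->
  \sum_(j < L.*2.+1) expR (- (`|j%:R - L%:R| / k)) <= 2 * k + 1.
Proof.
move=> k0; pose x := expR (- k^-1); have x0 : 0 < x by exact: expR_gt0.
have x1 : x < 1 by rewrite expR_lt1 oppr_lt0 invr_gt0.
have xk : x / (1 - x) <= k.
  rewrite ler_pdivrMr ?subr_gt0// mulrBr mulr1.
  have h : x * (1 + k^-1) <= 1.
    rewrite -[leRHS](expRxMexpNx_1 k^-1) mulrC ler_wpM2r ?expR_ge0//.
    exact: expR_ge1Dx.
  have : x * (1 + k^-1) * k <= 1 * k by rewrite ler_wpM2r// ltW.
  by rewrite mulrDr mulr1 mulrDl mulfVK ?gt_eqF// mul1r; lra.
have eE m : expR (- (m%:R / k)) = x ^+ m.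
  by rewrite -mulrN expRM_natl.
have xlt : 0 <= x < 1 by rewrite x1 ltW.
rewrite (_ : L.*2.+1 = L + L.+1)%N; last by rewrite addnS addnn.
rewrite big_split_ord /=.
have -> : 2 * k + 1 = k + (k + 1) by ring.
apply: lerD.
  apply: (@le_trans _ _ (\sum_(j < L) x ^+ j.+1)).
    rewrite (reindex_inj rev_ord_inj) /=; apply: ler_sum => j _.
    rewrite -eE ler_expR lerN2 ler_wpM2r ?invr_ge0 ?(ltW k0)//.
    rewrite distrC ger0_norm ?subr_ge0 ?ler_nat ?leq_subr//.
    by rewrite -natrB ?leq_subr// ler_nat subKn.
  under eq_bigr do rewrite exprS.
  rewrite -mulr_sumr; apply: le_trans xk.
  by rewrite ler_wpM2l ?(ltW x0)// sum_geometric_le.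
apply: (@le_trans _ _ (\sum_(j < L.+1) x ^+ j)).
  by apply: ler_sum => j _; rewrite natrD addrAC subrr add0r normr_nat eE.
apply: (le_trans (sum_geometric_le _ xlt)).
have -> : (1 - x)^-1 = x / (1 - x) + 1.
  by field; lra.
by rewrite lerD2r.
Qed.

(** Encodes the integer points with coordinates between -L and L. The truncation only makes the
    index type finite; no estimate depends on [L]. *)
Definition box (d L : nat) := {ffun 'I_d -> 'I_L.*2.+1}.

Definition box_pt (R : realType) (d L : nat) (f : box d L) : 'rV[R]_d :=
  \row_i ((f i)%:R - L%:R).

(** Exponential substitute for the indicator of the l1 ball of radius k d: at least 1 on that ball,
    and a product over the coordinates. *)
Definition box_weight (R : realType) (d L : nat) (k : R) (f : box d L) : R :=
  expR (d%:R - (\sum_i `|box_pt R f ord0 i|) / k).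

Lemma sum_box_weight (R : realType) (d L : nat) (k : R) : 0 < k ->
  \sum_(f : box d L) box_weight k f <= (expR 1 * (2 * k + 1)) ^+ d.
Proof.
move=> k0.
rewrite (_ : \sum_f _ = \prod_(i < d) \sum_(j < L.*2.+1)
    (expR 1 * expR (- (`|j%:R - L%:R| / k)))).
  rewrite -[X in _ <= _ ^+ X]card_ord -prodr_const; apply: ler_prod => i _.
  rewrite sumr_ge0 => [/=|j _]; last by rewrite mulr_ge0 ?expR_ge0.
  by rewrite -mulr_sumr ler_wpM2l ?expR_ge0// sum_expR_dist_le.
rewrite bigA_distr_bigA; apply: eq_bigr => f _.
rewrite /box_weight mulr_suml.
have -> : d%:R - \sum_(i < d) `|box_pt R f ord0 i| / k =
    \sum_(i < d) (1 - `|(f i)%:R - L%:R| / k).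
  rewrite sumrB sumr_const card_ord.
  by congr (_ - _); apply: eq_bigr => i _; rewrite mxE.
by rewrite expR_sum; apply: eq_bigr => i _; rewrite expRD.
Qed.

Lemma box_weight_ge0 (R : realType) (d L : nat) (k : R) (f : box d L) :
  0 <= box_weight k f.
Proof. exact: expR_ge0. Qed.

Lemma box_weight_ge1 (R : realType) (d L : nat) (k : R) (f : box d L) :
  0 < k -> \sum_i `|box_pt R f ord0 i| <= k * d%:R -> 1 <= box_weight k f.
Proof.
move=> k0 h; rewrite -expR0 ler_expR subr_ge0 ler_pdivrMr//.
by rewrite mulrC.
Qed.

Lemma box_pt_surj (R : realType) (d L : nat) (z : 'I_d -> int) :
  (forall i, `|z i| <= L%:Z)%R ->
  exists f : box d L, forall i, box_pt R f ord0 i = (z i)%:~R.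
Proof.
move=> zL; exists [ffun i => inord (absz (z i + L%:Z))] => i.
rewrite mxE ffunE inordK; last by have := zL i; lia.
have h : (absz (z i + L%:Z))%:Z = z i + L%:Z by have := zL i; lia.
by rewrite !pmulrn h intrD addrK.
Qed.

(* Rounding [x i] up with probability its fractional part [th] leaves the mean of
   the quadratic error unchanged up to [th * (1 - th) <= 1 / 4], so one of the two
   choices is at least as good. *)
Lemma greedy_rounding (R : realType) (d : nat) (K : finType) (S : pred K)
    (x : 'I_d -> R) (b : K -> 'I_d -> R) (s : seq 'I_d) : uniq s ->
  exists z : 'I_d -> int, (forall i, `|(z i)%:~R - x i| <= 1) /\
  \sum_(n | S n) (\sum_(i <- s) ((z i)%:~R - x i) * b n i) ^+ 2 <=
  4^-1 * \sum_(n | S n) \sum_(i <- s) b n i ^+ 2.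
Proof.
elim: s => [_|i s IH /= /andP[nis us]].
  exists (fun i => Num.floor (x i)); split=> [i|].
    have /andP[f1 f2] := floor_itv (x i).
    by rewrite intrD in f2; rewrite ler_norml; lra.
  rewrite big1 => [|n _]; last by rewrite big_nil expr0n.
  by rewrite mulr_ge0 ?invr_ge0// sumr_ge0 => // n _; rewrite big_nil.
have [z [z1 zs]] := IH us.
pose a n := \sum_(j <- s) ((z j)%:~R - x j) * b n j.
pose th := x i - (Num.floor (x i))%:~R.
have /andP[f1 f2] := floor_itv (x i); rewrite intrD in f2.
have th0 : 0 <= th by rewrite /th; lra.
have th1 : th <= 1 by rewrite /th; lra.
(* The cross terms cancel because the rounding error has mean 0; its variance is th (1 - th). *)
have mean : (1 - th) * (\sum_(n | S n) (- th * b n i + a n) ^+ 2) +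
    th * (\sum_(n | S n) ((1 - th) * b n i + a n) ^+ 2) =
    \sum_(n | S n) (a n) ^+ 2 + th * (1 - th) * \sum_(n | S n) b n i ^+ 2.
  rewrite !mulr_sumr -!big_split /=; apply: eq_bigr => n _; ring.
have th4 : th * (1 - th) <= 4^-1 by have := sqr_ge0 (th - 2^-1); lra.
have b0 : 0 <= \sum_(n | S n) b n i ^+ 2 by apply: sumr_ge0 => n _; exact: sqr_ge0.
have [t [zi [zit zi1 tle]]] : exists t : R, exists zi : int,
    [/\ t = zi%:~R - x i, `|t| <= 1 &
     \sum_(n | S n) (t * b n i + a n) ^+ 2 <=
     \sum_(n | S n) a n ^+ 2 + 4^-1 * \sum_(n | S n) b n i ^+ 2].
  have [h|h] := leP (\sum_(n | S n) (- th * b n i + a n) ^+ 2)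
     (\sum_(n | S n) a n ^+ 2 + 4^-1 * \sum_(n | S n) b n i ^+ 2).
    exists (- th), (Num.floor (x i)); split => //; first by rewrite /th opprB.
    by rewrite normrN ger0_norm.
  exists (1 - th), (Num.floor (x i) + 1); split.
  - by rewrite intrD /th; lra.
  - by rewrite ger0_norm; lra.
  - rewrite leNgt; apply/negP => h'.
    move: mean h h' b0 th4.
    move: (\sum_(n | S n) (- th * _ + _) ^+ 2) (\sum_(n | S n) ((1 - th) * _ + _) ^+ 2)
      (\sum_(n | S n) a n ^+ 2) (\sum_(n | S n) b n i ^+ 2) => X Y Z W mean h h' b0 th4.
    have thW : th * (1 - th) * W <= 4^-1 * W by rewrite ler_wpM2r.
    (* If both choices exceeded the bound, so would their mean. Strictness is inherited from
       rounding up, whose weight is [th]; when [th] vanishes, rounding down alone gives the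
       contradiction. *)
    have [tp|tn] := ltP 0 th; last first.
      have t0 : th = 0 by apply/eqP; rewrite eq_le tn th0.
      by move: mean; rewrite t0 subr0 !mul0r mul1r !addr0; lra.
    have q1 : 0 <= (1 - th) * (X - (Z + 4^-1 * W)) by rewrite mulr_ge0//; lra.
    have q2 : 0 < th * (Y - (Z + 4^-1 * W)) by rewrite mulr_gt0//; lra.
    by lra.
exists (fun j => if j == i then zi else z j); split.
  by move=> j; case: eqP => [->|_]; rewrite -?zit.
apply: (@le_trans _ _ (\sum_(n | S n) (t * b n i + a n) ^+ 2)).
  apply: ler_sum => n _; rewrite big_cons eqxx -zit.
  rewrite le_eqVlt; apply/orP; left; apply/eqP; congr ((_ + _) ^+ 2).
  apply: eq_big_seq => j js; case: eqP => // ji.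
  by rewrite ji (negPf nis) in js.
apply: (le_trans tle).
under [X in _ <= _ * X]eq_bigr do rewrite big_cons.
by rewrite big_split /= mulrDr addrC lerD2l.
Qed.

Lemma dotpC (R : realType) d (u v : 'rV[R]_d) : dotp u v = dotp v u.
Proof. by apply: eq_bigr => i _; rewrite mulrC. Qed.

Lemma dotpDl (R : realType) d (u v w : 'rV[R]_d) :
  dotp (u + v) w = dotp u w + dotp v w.
Proof. by rewrite -big_split; apply: eq_bigr => i _; rewrite mxE mulrDl. Qed.

Lemma dotpBl (R : realType) d (u v w : 'rV[R]_d) :
  dotp (u - v) w = dotp u w - dotp v w.
Proof. by rewrite dotpDl -scaleN1r dotpZl mulN1r. Qed.

Lemma dotpDr (R : realType) d (u v w : 'rV[R]_d) :
  dotp u (v + w) = dotp u v + dotp u w.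
Proof. by rewrite dotpC dotpDl !(dotpC u). Qed.

Lemma dotpBr (R : realType) d (u v w : 'rV[R]_d) :
  dotp u (v - w) = dotp u v - dotp u w.
Proof. by rewrite dotpC dotpBl !(dotpC u). Qed.

Lemma dotp_sum (R : realType) d (u : 'rV[R]_d) : dotp u u = \sum_i u ord0 i ^+ 2.
Proof. by apply: eq_bigr => i _; rewrite expr2. Qed.

Lemma dotp_CS (R : realType) d (u v : 'rV[R]_d) :
  `|dotp u v| <= enorm u * enorm v.
Proof.
rewrite -(ler_pXn2r (n := 2)) ?nnegrE ?mulr_ge0 ?enorm_ge0//.
rewrite real_normK ?num_real// exprMn !enorm_sqr.
have [v0|v0] := eqVneq (dotp v v) 0.
  have vi i : v ord0 i = 0.
    have := v0; rewrite dotp_sum => /eqP; rewrite psumr_eq0 => [/allP h|j _]; last exact: sqr_ge0.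
    by have := h i (mem_index_enum i); rewrite sqrf_eq0 => /eqP.
  rewrite v0 mulr0 (_ : dotp u v = 0) ?expr0n//.
  by rewrite /dotp big1// => i _; rewrite vi mulr0.
have v1 : 0 < dotp v v by rewrite lt_neqAle eq_sym v0 dotp_ge0.
have := dotp_ge0 (u - (dotp u v / dotp v v) *: v).
rewrite dotpBl !dotpBr !dotpZl !dotpZr (dotpC v u).
set a := dotp u u; set b := dotp u v; set c := dotp v v in v0 v1 *.
rewrite [X in 0 <= X](_ : _ = (a * c - b ^+ 2) / c); last by field.
by rewrite pmulr_lge0 ?invr_gt0// subr_ge0.
Qed.

Lemma enormD (R : realType) d (u v : 'rV[R]_d) :
  enorm (u + v) <= enorm u + enorm v.
Proof.
rewrite -(ler_pXn2r (n := 2)) ?nnegrE ?addr_ge0 ?enorm_ge0//.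
rewrite sqrrD !enorm_sqr dotpDl !dotpDr (dotpC v u).
have := le_trans (ler_norm _) (dotp_CS u v); rewrite -mulr_natr; lra.
Qed.

Lemma enormN (R : realType) d (u : 'rV[R]_d) : enorm (- u) = enorm u.
Proof. by rewrite -scaleN1r enormZ normrN normr1 mul1r. Qed.

Lemma enorm_le_sup (R : realType) d (u : 'rV[R]_d) (h : R) :
  0 <= h -> (forall i, `|u ord0 i| <= h) -> enorm u <= h * Num.sqrt d%:R.
Proof.
move=> h0 uh; rewrite -(ler_pXn2r (n := 2)) ?nnegrE ?mulr_ge0 ?enorm_ge0 ?sqrtr_ge0//.
rewrite enorm_sqr exprMn sqr_sqrtr// dotp_sum mulr_natr -[X in _ *+ X]card_ord -sumr_const.
apply: ler_sum => i _; rewrite -(real_normK (num_real (u _ _))).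
by rewrite lerXn2r// nnegrE.
Qed.

Lemma coord_le_enorm (R : realType) d (u : 'rV[R]_d) i : `|u ord0 i| <= enorm u.
Proof.
rewrite -(ler_pXn2r (n := 2)) ?nnegrE ?enorm_ge0//.
rewrite enorm_sqr dotp_sum (bigD1 i)//= real_normK ?num_real// lerDl.
by apply: sumr_ge0 => j _; exact: sqr_ge0.
Qed.

Lemma sum_coord_le (R : realType) d (u : 'rV[R]_d) :
  \sum_i `|u ord0 i| <= Num.sqrt d%:R * enorm u.
Proof.
pose a : 'rV[R]_d := \row_i `|u ord0 i|; pose o : 'rV[R]_d := \row_i 1.
have -> : \sum_i `|u ord0 i| = dotp o a.
  by apply: eq_bigr => i _; rewrite !mxE mul1r.
have -> : Num.sqrt d%:R = enorm o.
  congr Num.sqrt; rewrite /dotp (eq_bigr (fun=> 1)); first by rewrite sumr_const card_ord.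
  by move=> i _; rewrite mxE mulr1.
have -> : enorm u = enorm a.
  congr Num.sqrt; apply: eq_bigr => i _.
  by rewrite mxE -!expr2 real_normK ?num_real.
by apply: le_trans (ler_norm _) (dotp_CS _ _).
Qed.

Lemma max_coord_ge (R : realType) d (u : 'rV[R]_d) : (0 < d)%N ->
  exists i, enorm u <= Num.sqrt d%:R * `|u ord0 i|.
Proof.
move=> d0; pose i0 := Ordinal d0.
pose i := [arg max_(i > i0) `|u ord0 i|]%O.
exists i; rewrite mulrC; apply: enorm_le_sup => // j.
by rewrite /i; case: arg_maxP => // k _ h; exact: h.
Qed.

(** A coordinate error of one mesh [h] amounts to a Euclidean error of at most h sqrt d, which moves
    the norm and every inner product with a unit vector by no more than that. In l1 norm, |u / h|_1
    <= sqrt d |u| / h, and rounding adds at most d. The error 1, not 1/2, leaves the choice of the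
    neighbour free. *)
Lemma lattice_pt_near (R : realType) (d L : nat) (u : 'rV[R]_d) (h k : R)
    (z : 'I_d -> int) : 0 < h -> 0 < k ->
  (forall i, `|(z i)%:~R - u ord0 i / h| <= 1) ->
  enorm u / h + 1 <= L%:R ->
  Num.sqrt d%:R * enorm u / h + d%:R <= k * d%:R ->
  exists f : box d L,
    [/\ forall i, box_pt R f ord0 i = (z i)%:~R,
        1 <= box_weight k f,
        enorm u - h * Num.sqrt d%:R <= enorm (h *: box_pt R f) &
        forall x, enorm x = 1 ->
          `|dotp (h *: box_pt R f) x| <= `|dotp u x| + h * Num.sqrt d%:R].
Proof.
move=> h0 k0 zu uL uk.
have zle i : `|(z i)%:~R| <= `|u ord0 i| / h + 1 :> R.
  have := ler_normD ((z i)%:~R - u ord0 i / h) (u ord0 i / h).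
  rewrite subrK normrM [`|h^-1|]gtr0_norm ?invr_gt0//; have := zu i; lra.
have [f fz] : exists f : box d L, forall i, box_pt R f ord0 i = (z i)%:~R.
  apply: box_pt_surj => i.
  rewrite -(ler_int R) intr_norm -pmulrn; apply: le_trans (zle i) _.
  apply: le_trans uL; rewrite lerD2r ler_wpM2r ?invr_ge0 ?(ltW h0)//.
  exact: coord_le_enorm.
have near : enorm (h *: box_pt R f - u) <= h * Num.sqrt d%:R.
  apply: enorm_le_sup => [|i]; first exact: ltW.
  have -> : (h *: box_pt R f - u) ord0 i = h * ((z i)%:~R - u ord0 i / h).
    have -> : box_pt R f = \row_j (z j)%:~R by apply/rowP => j; rewrite [RHS]mxE fz.
    by rewrite !mxE; field; lra.
  by rewrite normrM gtr0_norm// ler_piMr// ltW.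
exists f; split=> [//|||x x1].
- apply: box_weight_ge1 => //; apply: le_trans uk.
  apply: (@le_trans _ _ (\sum_i (`|u ord0 i| / h + 1))).
    by apply: ler_sum => i _; rewrite fz.
  rewrite big_split /= sumr_const card_ord lerD2r -mulr_suml.
  by rewrite ler_wpM2r ?invr_ge0 ?(ltW h0)// sum_coord_le.
- have := enormD (h *: box_pt R f) (u - h *: box_pt R f).
  by rewrite addrC subrK -(enormN (u - _)) opprB; lra.
- have -> : dotp (h *: box_pt R f) x = dotp u x + dotp (h *: box_pt R f - u) x.
    by rewrite -dotpDl addrC subrK.
  apply: le_trans (ler_normD _ _) _; rewrite lerD2l.
  by apply: le_trans (dotp_CS _ _) _; rewrite x1 mulr1.
Qed.

(** If exactly one class [j] contains the observation [(x, e)], the value is [c j]. The form with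
    product indicators makes its expectation computable by independence. *)
Definition obs_factor (R : realType) d (J : finType) (c : J -> R)
    (A : J -> set 'rV[R]_d) (I : J -> set R) (x : 'rV[R]_d) (e : R) : R :=
  \sum_j c j * (\1_(A j) x * \1_(I j) e).

(** Weighted union bound before taking expectations: [Q] keeps the lattice points of large norm, and
    the product over the measurements is the exponential moment attached to the point. *)
Definition net_sum (R : realType) (T : Type) d N (phi : 'I_N -> T -> 'rV[R]_d)
    (eps : 'I_N -> T -> R) (F : finType) (om : F -> R) (Q : pred F)
    (J : finType) (c : J -> R) (A : F -> J -> set 'rV[R]_d) (I : J -> set R)
    (w : T) : R :=
  \sum_(f | Q f) om f * \prod_n obs_factor c (A f) I (phi n w) (eps n w).

(* Vanishes exactly when every [eps n w] lies in [[- delta, delta]] and every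
   [phi n w] on the sphere; at least 1 otherwise. *)
Definition null_sum (R : realType) (T : Type) d N (delta : R)
    (phi : 'I_N -> T -> 'rV[R]_d) (eps : 'I_N -> T -> R) (w : T) : R :=
  \sum_n (\1_(~` `[- delta, delta]) (eps n w) + \1_[set x | enorm x != 1] (phi n w)).

Lemma obs_factor_ge0 (R : realType) d (J : finType) (c : J -> R)
    (A : J -> set 'rV[R]_d) (I : J -> set R) (x : 'rV[R]_d) (e : R) :
  (forall j, 0 <= c j) -> 0 <= obs_factor c A I x e.
Proof. by move=> c0; apply: sumr_ge0 => j _; rewrite !mulr_ge0. Qed.

Lemma net_sum_ge0 (R : realType) (T : Type) d N (phi : 'I_N -> T -> 'rV[R]_d)
    (eps : 'I_N -> T -> R) (F : finType) (om : F -> R) (Q : pred F)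
    (J : finType) (c : J -> R) (A : F -> J -> set 'rV[R]_d) (I : J -> set R) w :
  (forall j, 0 <= c j) -> (forall f, 0 <= om f) ->
  0 <= net_sum phi eps om Q c A I w.
Proof.
move=> c0 om0; apply: sumr_ge0 => f _; rewrite mulr_ge0// prodr_ge0// => n _.
exact: obs_factor_ge0.
Qed.

Lemma null_sum_ge0 (R : realType) (T : Type) d N (delta : R)
    (phi : 'I_N -> T -> 'rV[R]_d) (eps : 'I_N -> T -> R) (w : T) :
  0 <= null_sum delta phi eps w.
Proof. by apply: sumr_ge0 => n _; rewrite addr_ge0. Qed.

Lemma null_sum_dichotomy (R : realType) (T : Type) d N (delta : R)
    (phi : 'I_N -> T -> 'rV[R]_d) (eps : 'I_N -> T -> R) (w : T) :
  1 <= null_sum delta phi eps w \/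
  forall n, - delta <= eps n w <= delta /\ enorm (phi n w) = 1.
Proof.
have [h|h] := pselect (forall n, - delta <= eps n w <= delta /\ enorm (phi n w) = 1).
  by right.
left; move/existsNP : h => [n nE]; rewrite /null_sum (bigD1 n)//=.
apply: ler_wpDr; first by apply: sumr_ge0 => m _; rewrite addr_ge0.
move/not_andP : nE => [ne|np].
  rewrite [X in X + _]indicE mem_set ?lerDl//= in_itv/=; exact/negP.
rewrite [X in _ + X]indicE mem_set ?lerDr//=; exact/eqP.
Qed.

(** By independence each point of [Q] contributes at most its weight times p^N; the other weights
    are added for free, so that [sum_box_weight] applies. As [null_sum] integrates to 0, adding it
    allows almost sure properties of noises and directions to be used pointwise. *)
Lemma net_expectation (R : realType) dsp (T : measurableType dsp)
    (P : probability T R) d N delta (phi : 'I_N -> T -> 'rV[R]_d)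
    (eps : 'I_N -> T -> R) (F : finType) (om : F -> R) (Q : pred F)
    (J : finType) (c : J -> R) (A : F -> J -> set 'rV[R]_d) (I : J -> set R)
    (p : R) :
  model P delta phi eps -> 0 <= p ->
  (forall f, 0 <= om f) -> (forall j, 0 <= c j) ->
  (forall f j, rV_borel (A f j)) -> (forall j, measurable (I j)) ->
  (forall f n, Q f -> \sum_j c j * (fine (P (phi n @^-1` A f j)) *
                                    fine (P (eps n @^-1` I j))) <= p) ->
  let g w := net_sum phi eps om Q c A I w + null_sum delta phi eps w in
  measurable_fun setT g /\
  (\int[P]_w (g w)%:E <= ((\sum_f om f) * p ^+ N)%:E)%E.
Proof.
move=> mod p0 om0 c0 mA mI pA g.
have mnull1 n : measurable (eps n @^-1` (~` `[- delta, delta])).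
  have [_ me _ _ _] := mod; have := me n measurableT (~` `[- delta, delta]).
  by rewrite setTI; apply; exact: measurableC.
have mnull2 n : measurable (phi n @^-1` [set x | enorm x != 1]).
  by have [mphi _ _ _ _] := mod; apply: mphi; exact: rV_borel_off_sphere.
have nullE w : null_sum delta phi eps w =
   \sum_n (\1_(eps n @^-1` (~` `[- delta, delta])) w + \1_(phi n @^-1` [set x | enorm x != 1]) w).
  by [].
have mn n : measurable_fun setT (fun w => \1_(eps n @^-1` (~` `[- delta, delta])) w + \1_(phi n @^-1` [set x | enorm x != 1]) w : R).
  by apply: measurable_funD; exact: measurable_indic.
have mnull : measurable_fun setT (null_sum delta phi eps) by exact: measurable_sum.
have Enull : (\int[P]_w (null_sum delta phi eps w)%:E = 0)%E.
  under eq_integral => w _ do rewrite nullE -sumEFin.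
  rewrite ge0_integral_sum//; last by move=> n; exact/measurable_EFinP.
  rewrite big1// => n _; under eq_integral => w _ do rewrite EFinD.
  rewrite ge0_integralD//; last 2 first.
  - by apply/measurable_EFinP; exact: measurable_indic.
  - by apply/measurable_EFinP; exact: measurable_indic.
  rewrite !integral_indic// !setIT.
  rewrite [X in (X + _)%E](model_eps_off n mod) [X in (_ + X)%E](model_phi_off_sphere n mod).
  by rewrite adde0.
have mprod f := model_expectation_prod mod c0 (mA f) mI.
have mt f : measurable_fun setT (fun w => om f * \prod_n obs_factor c (A f) I (phi n w) (eps n w)).
  by apply: measurable_funM => //; have [] := mprod f.
have mnet : measurable_fun setT (net_sum phi eps om Q c A I).
  have -> : net_sum phi eps om Q c A I = fun w => \sum_f
      (if Q f then om f * \prod_n obs_factor c (A f) I (phi n w) (eps n w) else 0).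
    by apply/funext => w; exact: big_mkcond.
  apply: measurable_sum => f. by case: (Q f).
split; first exact: measurable_funD.
under eq_integral => w _ do rewrite /g EFinD.
rewrite ge0_integralD//; last 4 first.
- by move=> w _; rewrite lee_fin net_sum_ge0.
- exact/measurable_EFinP.
- by move=> w _; rewrite lee_fin null_sum_ge0.
- exact/measurable_EFinP.
rewrite Enull adde0 /net_sum.
under eq_integral => w _ do rewrite -sumEFin (@big_mkcond _ _ _ _ _ Q).
rewrite ge0_integral_sum//; last 2 first.
- by move=> f; case: (Q f) => //; exact/measurable_EFinP.
- move=> f w _; case: ifP => // _; rewrite lee_fin mulr_ge0// prodr_ge0// => n _.
  exact: obs_factor_ge0.
rewrite mulr_suml -sumEFin; apply: lee_sum => f _.
have [Qf|Qf] := boolP (Q f); last first.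
  by rewrite integral0 lee_fin mulr_ge0// exprn_ge0.
under eq_integral => w _ do rewrite EFinM.
rewrite ge0_integralZl//; last 3 first.
- by apply/measurable_EFinP; have [] := mprod f.
- by move=> w _; rewrite lee_fin prodr_ge0// => n _; exact: obs_factor_ge0.
- by rewrite lee_fin.
have [_ ->] := mprod f.
rewrite -EFinM lee_fin ler_wpM2l//.
rewrite -[X in _ <= _ ^+ X]card_ord -prodr_const; apply: ler_prod => n _.
by rewrite pA// andbT; apply: sumr_ge0 => j _; rewrite !mulr_ge0 ?fine_ge0.
Qed.

(** * Small radii: noises near the endpoints *)

(** Half-open, so that the two intervals stay disjoint at [a = 1]. A noise in the left one forces
    <u, phi> < a delta on every u in [PN], one in the right one -<u, phi> < a delta; [side] records
    this sign. *)
Definition edge (R : realType) (delta a : R) (b : bool) : set R :=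
  if b then `[- delta, - delta + a * delta[%classic
  else `]delta - a * delta, delta]%classic.

Definition side (R : realType) (b : bool) : R := if b then 1 else -1.

(* [inl tt]: the noise is away from both endpoints; [inr (b, bad)]: the noise is
   near the endpoint [b], and [bad] tells whether the point [v] then violates
   the constraint with a margin. Since [(51 / 50) ^+ 1023 >= 20], the product of
   the coefficients is at least 1 once at most one constraint in 1024 is bad. *)
Definition bulk_coef (R : realType) (o : unit + bool * bool) : R :=
  match o with inl _ => 1 | inr (_, true) => 1 / 20 | inr (_, false) => 51 / 50 end.
Definition bulk_dir (R : realType) d (c : R) (v : 'rV[R]_d) (o : unit + bool * bool) :
    set 'rV[R]_d :=
  match o with
  | inl _ => setT
  | inr (b, true) => ~` [set x | dotp (side R b *: v) x < c]
  | inr (b, false) => [set x | dotp (side R b *: v) x < c]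
  end.
Definition bulk_noise (R : realType) (delta a : R) (o : unit + bool * bool) : set R :=
  match o with
  | inl _ => ~` (edge delta a true `|` edge delta a false)
  | inr (b, _) => edge delta a b
  end.

Lemma edge_disjoint (R : realType) (delta a : R) b b' (e : R) :
  0 < delta -> 0 <= a <= 1 -> edge delta a b e -> edge delta a b' e -> b = b'.
Proof.
move=> d0 /andP[a0 a1].
by case: b; case: b' => //=; rewrite !in_itv/= => /andP[h1 h2] /andP[h3 h4]; nra.
Qed.

Lemma factor_active (R : realType) d (J : finType) (c : J -> R)
    (A : J -> set 'rV[R]_d) (I : J -> set R) (x : 'rV[R]_d) (e : R) (j : J) :
  A j x -> I j e -> (forall j', A j' x -> I j' e -> j' = j) ->
  obs_factor c A I x e = c j.
Proof.
move=> Ax Ie uniq_j; rewrite /obs_factor (bigD1 j)//= !indicE !mem_set// !mulr1.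
rewrite big1 ?addr0// => j' jj'; rewrite !indicE.
have [/set_mem Ax'|_] := boolP (x \in A j'); last by rewrite mul0r mulr0.
have [/set_mem Ie'|_] := boolP (e \in I j'); last by rewrite !mulr0.
by rewrite (uniq_j j' Ax' Ie') eqxx in jj'.
Qed.

Lemma bulk_factor_off (R : realType) d (c delta a : R) (v x : 'rV[R]_d) (e : R) :
  (forall b, ~ edge delta a b e) ->
  obs_factor (@bulk_coef R) (bulk_dir c v) (bulk_noise delta a) x e = 1.
Proof.
move=> ne; apply: (@factor_active _ _ _ _ _ _ _ _ (inl tt)) => //=.
  by move=> [/(ne true)|/(ne false)].
by case=> [[]//|[b bad]] _ /= /ne.
Qed.

Lemma bulk_factor_edge (R : realType) d (c delta a : R) (v x : 'rV[R]_d) (e : R) b :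
  0 < delta -> 0 <= a <= 1 -> edge delta a b e ->
  obs_factor (@bulk_coef R) (bulk_dir c v) (bulk_noise delta a) x e =
  if c <= dotp (side R b *: v) x then 1 / 20 else 51 / 50.
Proof.
move=> d0 a01 eb.
have off : ~ (~` (edge delta a true `|` edge delta a false)) e.
  by apply; case: b eb => eb; [left|right].
case: ifPn => h.
  apply: (@factor_active _ _ _ _ _ _ _ _ (inr (b, true))) => //=.
    by apply/negP; rewrite -leNgt.
  case=> [[] _ /off //|[b' []] /= h' /(edge_disjoint d0 a01 eb) bb'].
    by rewrite bb'.
  by move: h'; rewrite -bb' ltNge h.
apply: (@factor_active _ _ _ _ _ _ _ _ (inr (b, false))) => //=.
  by rewrite ltNge.
case=> [[] _ /off //|[b' []] /= h' /(edge_disjoint d0 a01 eb) bb'].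
  by move: h'; rewrite -bb' => /negP; rewrite -leNgt (negPf h).
by rewrite bb'.
Qed.

Lemma pow_51_50_ge (R : realType) n : 950 <= n%:R :> R -> 20 <= (51 / 50 : R) ^+ n.
Proof.
move=> n950; have -> : (51 / 50 : R) = 1 - (- (1 / 50)) by lra.
have x1 : - (1 / 50) <= 1 :> R by lra.
by apply: le_trans (Bernoulli_ge n x1); lra.
Qed.

Lemma prod_two_values_ge1 (R : realType) (K : finType) (S B : pred K) (w : K -> R) :
  (forall n, B n -> S n) ->
  (forall n, ~~ S n -> w n = 1) ->
  (forall n, B n -> w n = 1 / 20) ->
  (forall n, S n -> ~~ B n -> w n = 51 / 50) ->
  (1024 * #|B| <= #|S|)%N -> 1 <= \prod_n w n.
Proof.
move=> BS w1 wB wS BSc.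
rewrite (bigID B) /= (eq_bigr (fun=> 1 / 20)) => [|n]; last exact: wB.
rewrite prodr_const (bigID S) /= [X in _ * (_ * X)]big1 => [|n /andP[_]]; last exact: w1.
rewrite mulr1 (eq_bigr (fun=> 51 / 50)) => [|n /andP[nB Sn]]; last exact: wS.
rewrite prodr_const.
have -> : #|[pred n | ~~ B n & S n]| = (#|S| - #|B|)%N.
  rewrite -(cardID B S) (_ : #|[predI S & B]| = #|B|) ?addKn; last first.
    by apply: eq_card => n; rewrite !inE; apply: andb_idl; exact: BS.
  by apply: eq_card => n; rewrite !inE.
have h : (1023 * #|B| <= #|S| - #|B|)%N by lia.
apply: (@le_trans _ _ ((1 / 20) ^+ #|B| * (51 / 50) ^+ (1023 * #|B|))); last first.
  apply: ler_wpM2l; [apply: exprn_ge0; lra|apply: ler_weXn2l => //; lra].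
rewrite exprM -exprMn exprn_ege1//.
have /pow_51_50_ge : 950 <= 1023%:R :> R by rewrite ler_nat.
by move: (_ ^+ 1023) => X; clear; lra.
Qed.

(** With mesh h = a delta / 16 one has |u| / h = 256 sqrt d, hence |u / h|_1 <= 256 d, and 257 d
    after rounding; the loss of norm h sqrt d is |u| / 256. The rounding is adapted to the
    observations, which is harmless because the union bound covers all lattice points. *)
Lemma bulk_net (R : realType) d N (delta a : R) (u : 'rV[R]_d)
    (x : 'I_N -> 'rV[R]_d) (e : 'I_N -> R) :
  (0 < d)%N -> 0 < delta -> 0 < a <= 1 ->
  enorm u = 16 * a * Num.sqrt d%:R * delta ->
  (forall n, enorm (x n) = 1) ->
  (forall n, `|dotp u (x n) - e n| <= delta) ->
  exists f : box d (257 * d), let v := (a * delta / 16) *: box_pt R f in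
    [/\ 255 / 256 * enorm u <= enorm v, 1 <= box_weight (257 : R) f &
        1 <= \prod_n obs_factor (@bulk_coef R) (bulk_dir (2 * a * delta) v)
               (bulk_noise delta a) (x n) (e n)].
Proof.
move=> d0 del0 /andP[a0 a1] un x1 xe.
pose h := a * delta / 16; have h0 : 0 < h by rewrite divr_gt0 ?mulr_gt0.
have q0 : 0 < Num.sqrt (d%:R : R) by rewrite sqrtr_gt0 ltr0n.
have q2 : Num.sqrt (d%:R : R) ^+ 2 = d%:R by rewrite sqr_sqrtr.
have d1 : 1 <= d%:R :> R by rewrite ler1n.
have qd : Num.sqrt (d%:R : R) <= d%:R by nra.
pose S n := `[< exists b, edge delta a b (e n) >].
have [z [z1 zs]] := @greedy_rounding R d _ S (fun i => u ord0 i / h)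
  (fun n i => x n ord0 i) (index_enum _) (index_enum_uniq _).
have uh : enorm u / h = 256 * Num.sqrt d%:R.
  by rewrite un /h; field; rewrite !gt_eqF.
have [||f [fz fw fv fx]] := @lattice_pt_near R d (257 * d) u h 257 z h0 (ltr0n R 257) z1.
- by rewrite uh natrM; lra.
- by rewrite -mulrA uh mulrCA -expr2 q2; lra.
pose v := h *: box_pt R f.
pose B n := `[< exists2 b, edge delta a b (e n) & 2 * a * delta <= dotp (side R b *: v) (x n) >].
exists f; split => //.
  have -> : 255 / 256 * enorm u = enorm u - h * Num.sqrt d%:R by rewrite un /h; field.
  exact: fv.
have ha : 16 * h = a * delta by rewrite /h; field.
have a01 : 0 <= a <= 1 by rewrite a1 ltW.
have BS n : B n -> S n by move=> /asboolP[b eb _]; apply/asboolP; exists b.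
apply: (@prod_two_values_ge1 R _ S B) => //.
- move=> n /asboolPn nS; apply: bulk_factor_off => b eb; apply: nS; by exists b.
- by move=> n /asboolP[b eb vb]; rewrite (bulk_factor_edge _ _ _ del0 a01 eb) ifT.
- move=> n /asboolP[b eb] /asboolPn nB; rewrite (bulk_factor_edge _ _ _ del0 a01 eb) ifF//.
  by apply/negP => vb; apply: nB; exists b.
have Ssum : \sum_(n | S n) \sum_(i <- index_enum _) x n ord0 i ^+ 2 = #|S|%:R.
  rewrite (eq_bigr (fun=> 1)) => [|n _]; last first.
    by have := x1 n; rewrite -dotp_sum -enorm_sqr => ->; rewrite expr1n.
  by rewrite sumr_const.
(* At a bad constraint the signed inner product is at most a delta for [u] but at least 2 a delta
   for [v], a rounding error of at least 16 h. In units of h its square is at least 256, while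
   greedy rounding of unit vectors leaves a total of at most |S| / 4; hence 1024 |B| <= |S|. *)
have Bsum : #|B|%:R * 256 <= \sum_(n | S n)
    (\sum_(i <- index_enum _) ((z i)%:~R - u ord0 i / h) * x n ord0 i) ^+ 2.
  rewrite (bigID B) /= -[leLHS]addr0; apply: lerD; last first.
    by apply: sumr_ge0 => n _; exact: sqr_ge0.
  rewrite (eq_bigl B) => [|n]; last first.
    by apply/andP/idP => [[]//|Bn]; split=> //; exact: BS.
  rewrite mulr_natl -sumr_const; apply: ler_sum => n /asboolP[b eb vb].
  have dE : h * (\sum_(i <- index_enum _) ((z i)%:~R - u ord0 i / h) * x n ord0 i) =
     dotp v (x n) - dotp u (x n).
    rewrite -dotpBl mulr_sumr; apply: eq_bigr => i _.
    have -> : v = \row_j (h * (z j)%:~R) by apply/rowP => j; rewrite !mxE -fz mxE.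
    by rewrite !mxE; field; rewrite gt_eqF.
  have h16 : 16 * h <= side R b * (dotp v (x n) - dotp u (x n)).
    have := xe n; rewrite ler_norml => /andP[x2 x3].
    move: vb; rewrite dotpZl; move: eb; rewrite ha.
    by case: b => /=; rewrite in_itv/= => /andP[e1 e2]; lra.
  move: h16; rewrite -dE [side R b * (h * _)]mulrCA [16 * h]mulrC ler_pM2l// => h16.
  have -> : forall t : R, t ^+ 2 = (side R b * t) ^+ 2.
    by move=> t; case: b {eb vb h16}; rewrite /= ?mul1r ?mulN1r ?sqrrN.
  by nra.
have : (1024 * #|B|)%:R <= #|S|%:R :> R.
  by move: (le_trans Bsum zs); rewrite Ssum natrM; lra.
by rewrite ler_nat.
Qed.

(** When all noises lie in [- delta, delta], the origin belongs to [PN]; so [WN] is nonnegative and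
    [PN] contains the segment from 0 to each of its points. The strict inequality yields a point
    beyond [s] without the supremum being attained. *)
Lemma WN_gt (R : realType) dsp (T : measurableType dsp) d N (delta s : R)
    (phi : 'I_N -> T -> 'rV[R]_d) (eps : 'I_N -> T -> R) (w : T) :
  0 < s -> (forall n, - delta <= eps n w <= delta) ->
  (s%:E < `|WN delta phi eps w|)%E ->
  exists2 u : 'rV[R]_d, enorm u = s &
    forall n, `|dotp u (phi n w) - eps n w| <= delta.
Proof.
move=> s0 ed; have W0 : (0%:E <= WN delta phi eps w)%E.
  apply: ereal_sup_ubound; exists 0 => /=; last first.
    by rewrite /enorm /dotp big1 ?sqrtr0// => i _; rewrite mxE mul0r.
  move=> n; rewrite /dotp big1 => [|i _]; last by rewrite mxE mul0r.
  by rewrite sub0r normrN ler_norml.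
rewrite gee0_abs// => /ereal_sup_gt[_ [u uP <-]]; rewrite lte_fin => su.
have u0 : 0 < enorm u by exact: lt_trans su.
pose t := s / enorm u.
have t0 : 0 <= t by rewrite divr_ge0// ltW.
have t1 : t <= 1 by rewrite ler_pdivrMr// mul1r ltW.
exists (t *: u); first by rewrite enormZ ger0_norm// /t divfK// gt_eqF.
move=> n; rewrite dotpZl; have := uP n; rewrite !ler_norml => /andP[h1 h2].
have /andP[e1 e2] := ed n.
by apply/andP; split; nra.
Qed.

Lemma sum_bool2 (V : nmodType) (F : bool * bool -> V) :
  \sum_p F p = F (true, true) + F (true, false) + (F (false, true) + F (false, false)).
Proof.
rewrite (eq_bigr (fun p => F (p.1, p.2))) => [|[]//].
by rewrite -(pair_bigA _ (fun b b' => F (b, b'))) /= !big_bool.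
Qed.

(** With x_b the probability of violation on side b, the sum is at most 1 - a + (a / 2) times the
    sum over b of 51/50 - 97/100 x_b. Outside the slab of half-width 2 a delta one of the sides is
    violated, so x_true + x_false >= 849/1000. The resulting rate, about 0.3917, is rounded down to
    48/125. *)
Lemma bulk_expectation_factor (R : realType) dsp (T : measurableType dsp)
    (P : probability T R) d N (delta a : R) (phi : 'I_N -> T -> 'rV[R]_d)
    (eps : 'I_N -> T -> R) (v : 'rV[R]_d) n :
  model P delta phi eps -> (0 < d)%N -> 0 < delta -> 0 < a <= 1 ->
  255 / 256 * (16 * a * Num.sqrt d%:R * delta) <= enorm v ->
  \sum_j bulk_coef R j * (fine (P (phi n @^-1` bulk_dir (2 * a * delta) v j)) *
                   fine (P (eps n @^-1` bulk_noise delta a j)))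
    <= 1 - 48 / 125 * a.
Proof.
move=> mod d0 del0 /andP[a0 a1] hv.
have q0 : 0 < Num.sqrt (d%:R : R) by rewrite sqrtr_gt0 ltr0n.
pose q := a * Num.sqrt d%:R * delta.
have q1 : 0 < q by rewrite !mulr_gt0.
have {}hv : 255 / 16 * q <= enorm v.
  apply: le_trans hv; rewrite le_eqVlt; apply/orP; left; apply/eqP.
  by rewrite /q; field.
have v0 : 0 < enorm v by lra.
have [mphi meps _ _ _] := mod.
have mep (B : set R) : measurable B -> measurable (eps n @^-1` B).
  by move=> mB; have := meps n measurableT _ mB; rewrite setTI.
have medge b : measurable (edge delta a b) by case: b; exact: measurable_itv.
have Pe b : fine (P (eps n @^-1` edge delta a b)) = a / 2.
  by case: b; [apply: (model_eps_left n mod)|apply: (model_eps_right n mod)]; lra.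
have Poff : fine (P (eps n @^-1` (~` (edge delta a true `|` edge delta a false)))) <= 1 - a.
  rewrite -preimage_setC probability_setC; last by apply: mep; exact: measurableU.
  rewrite preimage_setU measureU; first last.
  - have a01 : 0 <= a <= 1 by rewrite a1 ltW.
    by apply/seteqP; split => w //= [e1 e2]; have := @edge_disjoint R delta a true false _ del0 a01 e1 e2.
  - exact: mep.
  - exact: mep.
  rewrite -(fineK (fin_num_measure P _ (mep _ (medge true)))).
  rewrite -(fineK (fin_num_measure P _ (mep _ (medge false)))).
  by rewrite !Pe -EFinD /=; lra.
pose c := 2 * a * delta.
pose Hs b := phi n @^-1` [set x | dotp (side R b *: v) x < c].
have mH b : measurable (Hs b) by apply: mphi; exact: rV_borel_dotp_lt.
have fH b : P (Hs b) \is a fin_num by rewrite fin_num_measure.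
have PHC b : fine (P (~` Hs b)) = 1 - fine (P (Hs b)).
  by rewrite probability_setC// -(fineK (fH b)).
pose x b := fine (P (~` Hs b)).
have sumx : 849 / 1000 <= x true + x false.
  (* The slab estimate gives (12/5) / (255/16) = 0.1505... *)
  have slab : fine (P (phi n @^-1` [set y | `|dotp v y| <= c])) <= 151 / 1000.
    apply: (le_trans (model_phi_slab n mod d0 v0 _)); first by rewrite /c !mulr_ge0// ltW.
    rewrite ler_pdivrMr// (_ : _ * _ * _ = 12 / 5 * q); last by rewrite /c /q; field.
    lra.
  have mS : measurable (phi n @^-1` [set y | `|dotp v y| <= c]).
    by apply: mphi; exact: rV_borel_slab.
  have fS := fin_num_measure P _ mS.
  have cover : ~` (phi n @^-1` [set y | `|dotp v y| <= c]) `<=` (~` Hs true `|` ~` Hs false).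
    move=> w /= /negP; rewrite -ltNge ltr_normr => /orP[h|h]; [left|right];
      rewrite /Hs /= dotpZl /side ?mul1r ?mulN1r => h'; lra.
  have mC b : measurable (~` Hs b) by exact: measurableC.
  have mSC := measurableC mS; have mU := measurableU _ _ (mC true) (mC false).
  have h : (P (~` (phi n @^-1` [set y | (`|dotp v y| <= c)%R])) <=
            P (~` Hs true) + P (~` Hs false))%E.
    apply: (@le_trans _ _ (P (~` Hs true `|` ~` Hs false))).
      by apply: le_measure; rewrite ?inE.
    exact: measureU2.
  move: h; rewrite probability_setC// -(fineK fS).
  rewrite -(fineK (fin_num_measure P _ (mC true))) -(fineK (fin_num_measure P _ (mC false))).
  rewrite -EFinB -EFinD lee_fin /x; lra.
rewrite big_sumType /= (big_pred1 tt) => [|[]//].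
rewrite preimage_setT probability_setT /=.
rewrite sum_bool2.
suff : 1 * (1 * fine (P (eps n @^-1` (~` (edge delta a true `|` edge delta a false))))) +
    (1 / 20 * (x true * fine (P (eps n @^-1` edge delta a true))) +
     51 / 50 * (fine (P (Hs true)) * fine (P (eps n @^-1` edge delta a true))) +
     (1 / 20 * (x false * fine (P (eps n @^-1` edge delta a false))) +
      51 / 50 * (fine (P (Hs false)) * fine (P (eps n @^-1` edge delta a false)))))
    <= 1 - 48 / 125 * a by [].
rewrite !Pe.
have xE b : fine (P (Hs b)) = 1 - x b by rewrite /x PHC; lra.
rewrite !xE.
move: (x true) (x false) sumx Poff => x1 x2 sumx; move: (fine _) => y Poff.
have := ler_wpM2l (ltW a0) sumx; rewrite mulrDr; lra.
Qed.

(* [P (|WN| > s) <= p] in a form insensitive to the measurability of [WN]. *)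
Definition tail_bound (R : realType) dsp (T : measurableType dsp)
    (P : probability T R) d N (delta : R) (phi : 'I_N -> T -> 'rV[R]_d)
    (eps : 'I_N -> T -> R) (s p : R) : Prop :=
  exists g : T -> R, [/\ measurable_fun setT g, forall w, 0 <= g w,
    forall w, (s%:E < `|WN delta phi eps w|)%E -> 1 <= g w &
    (\int[P]_w (g w)%:E <= p%:E)%E].

Lemma bulk_tail_bound (R : realType) dsp (T : measurableType dsp)
    (P : probability T R) d N (delta a : R) (phi : 'I_N -> T -> 'rV[R]_d)
    (eps : 'I_N -> T -> R) :
  model P delta phi eps -> (0 < d)%N -> 0 < delta -> 0 < a <= 1 ->
  tail_bound P delta phi eps (16 * a * Num.sqrt d%:R * delta)
    ((expR 1 * 515) ^+ d * (1 - 48 / 125 * a) ^+ N).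
Proof.
move=> mod d0 del0 a01; have /andP[a0 a1] := a01.
have q0 : 0 < Num.sqrt (d%:R : R) by rewrite sqrtr_gt0 ltr0n.
set r := 16 * a * _ * _; have r0 : 0 < r by rewrite !mulr_gt0.
have k0 : 0 < (257 : R) by rewrite ltr0n.
pose L := (257 * d)%N.
pose pt (f : box d L) : 'rV[R]_d := (a * delta / 16) *: box_pt R f.
pose Q (f : box d L) := 255 / 256 * r <= enorm (pt f).
pose om (f : box d L) := box_weight (257 : R) f.
pose A (f : box d L) := bulk_dir (2 * a * delta) (pt f).
pose I := bulk_noise delta a.
have p0 : 0 <= 1 - 48 / 125 * a by lra.
have c0 j : 0 <= bulk_coef R j by case: j => [[]|[b []]] /=; rewrite ?ler01 ?divr_ge0.
have mA f j : rV_borel (A f j).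
  case: j => [[]|[b []]] /=.
  - exact: (@rV_borel_open R d (dotp 0) setT (@continuous_dotpl R d 0) openT).
  - apply: rV_borelC; exact: rV_borel_dotp_lt.
  - exact: rV_borel_dotp_lt.
have medge b : measurable (edge delta a b) by case: b; exact: measurable_itv.
have mI j : measurable (I j).
  case: j => [[]|[b bad]] /=; last exact: medge.
  by apply: measurableC; apply: measurableU; [exact: (medge true)|exact: (medge false)].
have pA f n : Q f -> \sum_j bulk_coef R j * (fine (P (phi n @^-1` A f j)) *
    fine (P (eps n @^-1` I j))) <= 1 - 48 / 125 * a.
  by move=> Qf; exact: bulk_expectation_factor.
have om0 f : 0 <= om f by exact: box_weight_ge0.
have [mg ig] := @net_expectation R dsp T P d N delta phi eps _ om Q _
  (@bulk_coef R) A I _ mod p0 om0 c0 mA mI pA.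
exists (fun w => net_sum phi eps om Q (@bulk_coef R) A I w + null_sum delta phi eps w).
split => //.
- by move=> w; rewrite addr_ge0 ?null_sum_ge0// net_sum_ge0// => f; exact: box_weight_ge0.
- move=> w Wr; have [h|h] := null_sum_dichotomy delta phi eps w.
    by rewrite ler_wpDl// net_sum_ge0// => f; exact: box_weight_ge0.
  rewrite ler_wpDr ?null_sum_ge0//.
  have [u ur uP] := WN_gt r0 (fun n => (h n).1) Wr.
  have [f [fQ fw fp]] := bulk_net d0 del0 a01 ur (fun n => (h n).2) uP.
  rewrite /net_sum (bigD1 f) /=; last by rewrite /Q -ur.
  apply: ler_wpDr; last by apply: mulr_ege1.
  apply: sumr_ge0 => f' _; rewrite mulr_ge0 ?box_weight_ge0// prodr_ge0// => n _.
  exact: obs_factor_ge0.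
- apply: le_trans ig _; rewrite lee_fin ler_wpM2r ?exprn_ge0//.
  apply: (le_trans (sum_box_weight _ _ k0)).
  by rewrite (_ : 2 * 257 + 1 = 515 :> R)//; lra.
Qed.

(** * Large radii: small-ball estimate *)

(** A single class, so that the factor is just the indicator of a slab and [net_expectation] serves
    both regimes. The width 3 delta in [far_dir] is 2 delta from the constraint plus delta from
    rounding with mesh delta / sqrt d. *)
Definition far_coef (R : realType) (j : unit) : R := 1.
Definition far_dir (R : realType) d (delta : R) (v : 'rV[R]_d) (j : unit) :
  set 'rV[R]_d := [set x | `|dotp v x| <= 3 * delta].
Definition far_noise (R : realType) (j : unit) : set R := setT.

Lemma sum_image_le (R : numDomainType) (I F : finType) (g : I -> F) (Q : pred F)
    (a : F -> R) :
  injective g -> (forall i, Q (g i)) -> (forall f, 0 <= a f) ->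
  \sum_i a (g i) <= \sum_(f | Q f) a f.
Proof.
move=> ginj Qg a0; rewrite (bigID [in finset.imset g (mem [set: I]%SET)]) /=.
apply: ler_wpDr; first by apply: sumr_ge0.
rewrite (eq_bigl [in finset.imset g (mem [set: I]%SET)]) => [|f]; last first.
  by apply/andP/idP => [[]//|fg]; split => //; have /imsetP[i _ ->] := fg.
rewrite big_imset /=; last by move=> i j _ _; exact: ginj.
by rewrite [leRHS](eq_bigl xpredT) // => i; rewrite finset.in_setT.
Qed.

(* Many points [t u] with [7 / 8 <= t <= 1] round to distinct lattice points, all
   of which nearly satisfy the constraints; this gains the factor [16 / r] of
   [far_tail_bound], which makes the dyadic sum converge when [N = d + 2]. *)
Lemma far_net (R : realType) d L N (delta r : R) (u : 'rV[R]_d)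
    (x : 'I_N -> 'rV[R]_d) (e : 'I_N -> R) :
  (0 < d)%N -> 0 < delta -> 16 * Num.sqrt d%:R <= r ->
  r * Num.sqrt d%:R + 1 <= L%:R ->
  enorm u = r * delta ->
  (forall n, enorm (x n) = 1) ->
  (forall n, - delta <= e n <= delta) ->
  (forall n, `|dotp u (x n) - e n| <= delta) ->
  let pt f : 'rV[R]_d := (delta / Num.sqrt d%:R) *: box_pt R f in
  is_true (r / 16 <= \sum_(f : box d L | 13 / 16 * r * delta <= enorm (pt f))
     box_weight (r + 1) f * \prod_n obs_factor (@far_coef R)
        (far_dir delta (pt f)) (@far_noise R) (x n) (e n)).
Proof.
move=> d0 del0 rd rL ur x1 e1 ux pt.
set q := Num.sqrt d%:R in rd rL pt *.
have q1 : 1 <= q by rewrite -sqrtr1 ler_wsqrtr// ler1n.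
have q0 : 0 < q by lra.
have q2 : q ^+ 2 = d%:R by rewrite sqr_sqrtr.
have r16 : 16 <= r by apply: le_trans rd; lra.
pose h := delta / q; have h0 : 0 < h by rewrite divr_gt0.
have hq : h * q = delta by rewrite /h divfK// gt_eqF.
have [i ui] := max_coord_ge u d0; rewrite -/q in ui.
pose X := `|u ord0 i| / h.
have Xr : r <= X.
  rewrite /X ler_pdivlMr// -(ler_pM2l q0); apply: le_trans ui.
  by rewrite ur mulrCA [q * h]mulrC hq.
have X0 : 0 < X by lra.
have ui0 : u ord0 i != 0.
  by apply/eqP => u0; move: X0; rewrite /X u0 normr0 mul0r ltxx.
(* The multiples t_j = (M - j) / X, j < m, make coordinate i of t_j u / h exactly the integer M - j
   up to sign, so that the rounded points are distinct. From M > X - 1 and j <= X / 8 - 1 follows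
   t_j >= 7/8, and m > X / 8 - 1 >= r / 16 since X >= r >= 16. *)
pose m := Num.truncn (X / 8); pose M := Num.truncn X.
have /andP[m1 m2] : m%:R <= X / 8 < m.+1%:R by apply: truncn_itv; lra.
have /andP[M1 M2] : M%:R <= X < M.+1%:R by apply: truncn_itv; lra.
rewrite -(natr1 m) in m2; rewrite -(natr1 M) in M2.
have m16 : r / 16 <= m%:R by lra.
apply: (le_trans m16).
have mM : (m <= M)%N by rewrite -(ler_nat R); lra.
pose t (j : 'I_m) : R := (M - j)%:R / X.
have tj (j : 'I_m) : (M - j)%:R = M%:R - j%:R :> R.
  by rewrite natrB// (leq_trans (ltnW (ltn_ord j))).
have jm (j : 'I_m) : j%:R + 1 <= m%:R :> R by rewrite natr1 ler_nat.
have t78 j : 7 / 8 <= t j by rewrite /t ler_pdivlMr// tj; have := jm j; lra.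
have t1 j : t j <= 1.
  by rewrite /t ler_pdivrMr// mul1r tj; have := ler0n R j; lra.
pose sg : int := if 0 <= u ord0 i then 1 else -1.
have sgE : u ord0 i / h = sg%:~R * X.
  rewrite /X mulrA; congr (_ / _); rewrite /sg; case: ifPn => h1.
    by rewrite ger0_norm// mul1r.
  by rewrite ltr0_norm ?mulrNN ?mul1r// ltNge.
pose z (j : 'I_m) (l : 'I_d) : int :=
  if l == i then sg * (M - j)%:Z else Num.floor (t j * u ord0 l / h).
have znear j l : `|(z j l)%:~R - (t j *: u) ord0 l / h| <= 1.
  rewrite /z mxE; case: eqP => [->|_].
    rewrite -mulrA sgE /t intrM -pmulrn mulrCA divfK ?gt_eqF// subrr normr0.
    exact: ler01.
  have /andP[f1 f2] := floor_itv (t j * u ord0 l / h); rewrite intrD in f2.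
  by rewrite ler_norml; lra.
have nt j : enorm (t j *: u) = t j * r * delta.
  by rewrite enormZ ur ger0_norm ?mulrA//; have := t78 j; lra.
have rh : r * delta / h = r * q by rewrite /h; field; rewrite !gt_eqF.
have tle j (y : R) : 0 <= y -> t j * y <= y.
  by move=> y0; rewrite ler_piMl.
have k0 : 0 < r + 1 by lra.
have near j : exists f : box d L,
    [/\ forall l, box_pt R f ord0 l = (z j l)%:~R,
        1 <= box_weight (r + 1) f,
        enorm (t j *: u) - h * q <= enorm (h *: box_pt R f) &
        forall x, enorm x = 1 ->
          `|dotp (h *: box_pt R f) x| <= `|dotp (t j *: u) x| + h * q].
  apply: lattice_pt_near => //.
  - apply: le_trans rL; rewrite lerD2r nt.
    rewrite (_ : _ / h = t j * (r * q)); last by rewrite -rh; ring.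
    by apply: tle; rewrite mulr_ge0//; lra.
  - rewrite -/q nt (_ : _ / h = t j * (r * d%:R)); last by rewrite -q2 /h; field; rewrite !gt_eqF.
    by rewrite mulrDl mul1r lerD2r; apply: tle; rewrite mulr_ge0//; lra.
have [g gP] := choice near.
have ginj : injective g.
  move=> j1 j2 g12; have [g1 _ _ _] := gP j1; have [g2 _ _ _] := gP j2.
  have := g1 i; rewrite g12 g2 => /eqP; rewrite eqr_int /z eqxx => /eqP zz.
  have sg0 : sg != 0 by rewrite /sg; case: ifP.
  have [{}zz] := mulfI sg0 zz.
  have jM (j : 'I_m) : (j <= M)%N by exact: leq_trans (ltnW (ltn_ord j)) mM.
  by apply: val_inj => /=; move/(congr1 (subn M)) : zz; rewrite !subKn ?jM.
(* Rounding costs delta <= r delta / 16, and 7/8 - 1/16 = 13/16. *)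
have Qg j : 13 / 16 * r * delta <= enorm (pt (g j)).
  have [_ _ + _] := gP j; rewrite hq nt => h1; apply: le_trans h1.
  have := t78 j; have rd16 : 16 * delta <= r * delta by rewrite ler_wpM2r// ltW.
  move=> t7; have : 7 / 8 * (r * delta) <= t j * (r * delta) by rewrite ler_wpM2r//; lra.
  by rewrite !mulrA; lra.
pose a (f : box d L) : R := box_weight (r + 1) f * \prod_n obs_factor (@far_coef R)
        (far_dir delta (pt f)) (@far_noise R) (x n) (e n).
have a0 f : 0 <= a f.
  rewrite mulr_ge0 ?box_weight_ge0// prodr_ge0// => n _; exact: obs_factor_ge0.
apply: le_trans (sum_image_le ginj Qg a0).
rewrite -[X in X%:R <= _]card_ord -sumr_const; apply: ler_sum => j _.
have [_ w1 _ slab] := gP j.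
rewrite /a big1 ?mulr1// => n _.
apply: (@factor_active _ _ _ _ _ _ _ _ tt) => //=; last by case.
rewrite /far_dir /=; apply: (le_trans (slab _ (x1 n))).
rewrite hq dotpZl normrM ger0_norm; last by have := t78 j; lra.
have := tle j _ (normr_ge0 (dotp u (x n))).
have : `|dotp u (x n)| <= 2 * delta.
  have := ler_normD (dotp u (x n) - e n) (e n); rewrite subrK.
  by have := ux n; have := e1 n; rewrite -ler_norml; lra.
lra.
Qed.

Lemma far_tail_bound (R : realType) dsp (T : measurableType dsp)
    (P : probability T R) d N (delta r : R) (phi : 'I_N -> T -> 'rV[R]_d)
    (eps : 'I_N -> T -> R) :
  model P delta phi eps -> (0 < d)%N -> 0 < delta -> 16 * Num.sqrt d%:R <= r ->
  tail_bound P delta phi eps (r * delta)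
    (16 / r * (expR 1 * (2 * r + 3)) ^+ d * (288 / 65 * Num.sqrt d%:R / r) ^+ N).
Proof.
move=> mod d0 del0 rd.
have q1 : 1 <= Num.sqrt (d%:R : R) by rewrite -[leLHS]sqrtr1 ler_wsqrtr// ler1n.
have r16 : 16 <= r by apply: le_trans rd; lra.
have r0 : 0 < r by lra.
have k0 : 0 < r + 1 by lra.
have [L rL] : exists L : nat, r * Num.sqrt d%:R + 1 <= L%:R.
  exists (Num.truncn (r * Num.sqrt d%:R + 1)).+1; apply: ltW; apply: truncnS_gt.
pose pt (f : box d L) : 'rV[R]_d := (delta / Num.sqrt d%:R) *: box_pt R f.
pose Q (f : box d L) := 13 / 16 * r * delta <= enorm (pt f).
(* The factor 16 / r normalizes the lower bound r / 16 of [far_net] to 1. *)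
pose om (f : box d L) := 16 / r * box_weight (r + 1) f.
pose A (f : box d L) := far_dir delta (pt f).
(* The slab estimate for half-width 3 delta and norm 13/16 r delta: 6/5 * 3 * 16/13 = 288/65. *)
pose p := 288 / 65 * Num.sqrt d%:R / r.
have p0 : 0 <= p by apply: divr_ge0; [apply: mulr_ge0; lra|exact: ltW].
have c0 j : 0 <= @far_coef R j by exact: ler01.
have s0 : 0 <= 16 / r by rewrite divr_ge0// ltW.
have om0 f : 0 <= om f by rewrite mulr_ge0 ?box_weight_ge0.
have mA f j : rV_borel (A f j) by exact: rV_borel_slab.
have mI j : measurable (@far_noise R j) by exact: measurableT.
have pA f n : Q f -> \sum_j @far_coef R j * (fine (P (phi n @^-1` A f j)) *
    fine (P (eps n @^-1` @far_noise R j))) <= p.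
  move=> Qf; rewrite (big_pred1 tt) => [|[]//].
  rewrite /far_noise preimage_setT probability_setT /= mulr1 mul1r.
  have v0 : 0 < enorm (pt f).
    by apply: lt_le_trans Qf; rewrite !mulr_gt0.
  have d3 : 0 <= 3 * delta by rewrite mulr_ge0// ltW.
  apply: (le_trans (model_phi_slab n mod d0 v0 d3)).
  rewrite ler_pdivrMr//.
  have : p * (13 / 16 * r * delta) <= p * enorm (pt f) by rewrite ler_wpM2l.
  apply: le_trans; rewrite le_eqVlt; apply/orP; left; apply/eqP.
  by rewrite /p; field; rewrite gt_eqF.
have [mg ig] := @net_expectation R dsp T P d N delta phi eps _ om Q _
  (@far_coef R) A (@far_noise R) p mod p0 om0 c0 mA mI pA.
exists (fun w => net_sum phi eps om Q (@far_coef R) A (@far_noise R) w + null_sum delta phi eps w).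
split => //.
- by move=> w; rewrite addr_ge0 ?null_sum_ge0// net_sum_ge0.
- move=> w Wr; have [h|h] := null_sum_dichotomy delta phi eps w.
    by rewrite ler_wpDl// net_sum_ge0.
  rewrite ler_wpDr ?null_sum_ge0//.
  have rdel0 : 0 < r * delta by rewrite mulr_gt0.
  have [u ur uP] := WN_gt rdel0 (fun n => (h n).1) Wr.
  have := far_net d0 del0 rd rL ur (fun n => (h n).2) (fun n => (h n).1) uP.
  move=> /(ler_wpM2l s0); rewrite mulr_sumr.
  rewrite (_ : 16 / r * (r / 16) = 1); last by field; rewrite gt_eqF.
  move=> /le_trans; apply; rewrite le_eqVlt; apply/orP; left; apply/eqP.
  by apply: eq_bigr => f _; rewrite mulrA.
- apply: le_trans ig _; rewrite lee_fin ler_wpM2r ?exprn_ge0//.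
  rewrite /om -mulr_sumr ler_wpM2l//.
  apply: (le_trans (sum_box_weight _ _ k0)).
  by rewrite (_ : 2 * (r + 1) + 1 = 2 * r + 3)//; lra.
Qed.

(** * Layer cake summation and constants *)

Lemma dyadic_bracket (R : realType) (s x : R) : 0 < s -> s < x ->
  exists k : nat, 2 ^+ k * s < x <= 2 ^+ k.+1 * s.
Proof.
move=> s0 sx.
have ex : exists k, x <= 2 ^+ k * s.
  exists (Num.truncn (x / s)).+1; rewrite -ler_pdivrMr//.
  apply: (@le_trans _ _ ((Num.truncn (x / s)).+1%:R)); first exact/ltW/truncnS_gt.
  by rewrite -natrX ler_nat ltnW// ltn_expl.
have := ex_minnP ex => -[[|k] xk mink].
  by rewrite expr0 mul1r leNgt sx in xk.
exists k; rewrite xk andbT ltNge; apply/negP => /mink; by rewrite ltnn.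
Qed.

(** Pointwise, |WN|^2 is at most s^2 plus the sum of 4 (2^k s)^2 g_k: if |WN| lies between 2^k s and
    2^(k+1) s, the k-th term alone suffices, the 4 being the square of the dyadic step. *)
Lemma layer_cake (R : realType) dsp (T : measurableType dsp)
    (P : probability T R) d N (delta s B : R) (phi : 'I_N -> T -> 'rV[R]_d)
    (eps : 'I_N -> T -> R) (p : nat -> R) :
  0 < s -> (forall k, tail_bound P delta phi eps (2 ^+ k * s) (p k)) ->
  (forall n, \sum_(0 <= k < n) 4 * (2 ^+ k * s) ^+ 2 * p k <= B) ->
  (EW2 P delta phi eps <= (s ^+ 2 + B)%:E)%E.
Proof.
move=> s0 tb pB; have [g gP] := choice tb.
pose c k : R := 4 * (2 ^+ k * s) ^+ 2.
have c0 k : 0 <= c k by rewrite mulr_ge0// sqr_ge0.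
pose S w : \bar R := (\sum_(0 <= k <oo) (c k * g k w)%:E)%E.
have cg0 k w : (0 <= (c k * g k w)%:E)%E.
  by have [_ g0 _ _] := gP k; rewrite lee_fin mulr_ge0.
have S0 w : (0 <= S w)%E by apply: nneseries_ge0 => k _ _; exact: cg0.
have S_ge w n : (\sum_(0 <= k < n) (c k * g k w)%:E <= S w)%E.
  by apply: nneseries_lim_ge => k _ _; exact: cg0.
have mcg k : measurable_fun setT (fun w => (c k * g k w)%:E : \bar R).
  by apply/measurable_EFinP; apply: measurable_funM => //; have [] := gP k.
apply: (@le_trans _ _ (\int[P]_w ((s ^+ 2)%:E + S w))%E).
  apply: ge0_le_integral_nonmeas => w; first by rewrite sqre_ge0.
  have W0 := abse_ge0 (WN delta phi eps w).
  move: W0 (fun k => let: And4 _ _ h _ := gP k in h w).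
  case: (`|WN delta phi eps w|)%E => [x| |]//= x0 gk; last first.
    (* If [WN] is infinite, every g_k is at least 1 and every term at least [c 0], so the series
       diverges as well. *)
    rewrite (_ : S w = +oo%E) ?leey//; apply/eqyP => A A0.
    pose n := (Num.truncn (A / c 0%N)).+1.
    have cp : 0 < c 0%N by rewrite mulr_gt0// exprn_gt0// mulr_gt0.
    apply: le_trans (S_ge w n); rewrite sumEFin lee_fin.
    apply: (@le_trans _ _ (\sum_(0 <= k < n) c 0%N)).
      rewrite sumr_const_nat subn0 -mulr_natr mulrC -ler_pdivrMr//.
      exact/ltW/truncnS_gt.
    apply: ler_sum => k _; apply: (@le_trans _ _ (c k)); last first.
      by rewrite ler_peMr//; apply: gk; rewrite ltry.
    rewrite ler_wpM2l// lerXn2r ?nnegrE ?mulr_ge0 ?(ltW s0)// expr0.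
    by rewrite ler_wpM2r ?(ltW s0)// exprn_ege1// ler1n.
  rewrite lee_fin in x0; rewrite -EFinM -expr2.
  have [xs|sx] := leP x s.
    apply: (@le_trans _ _ (s ^+ 2)%:E); last by rewrite leeDl.
    by rewrite lee_fin lerXn2r ?nnegrE ?(ltW s0).
  have [k /andP[kx xk]] := dyadic_bracket s0 sx.
  apply: (@le_trans _ _ (\sum_(0 <= j < k.+1) (c j * g j w)%:E)%E); last first.
    by apply: le_trans (S_ge w k.+1) _; rewrite leeDr// lee_fin sqr_ge0.
  rewrite big_nat_recr//= -[leLHS]add0e; apply: leeD.
    by apply: sume_ge0 => j _; exact: cg0.
  rewrite lee_fin; apply: (@le_trans _ _ (c k)); last first.
    by rewrite ler_peMr//; apply: gk; rewrite lte_fin.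
  apply: (@le_trans _ _ ((2 ^+ k.+1 * s) ^+ 2)).
    by rewrite lerXn2r ?nnegrE// mulr_ge0 ?(ltW s0).
  by rewrite /c (exprS 2 k) -mulrA; move: (2 ^+ k * s) => y; lra.
have mS : measurable_fun setT S.
  by apply: (@ge0_emeasurable_sum _ _ _ setT (fun k w => (c k * g k w)%:E) xpredT).
rewrite ge0_integralD//; last by move=> w _; rewrite lee_fin sqr_ge0.
have -> : (\int[P]_w (s ^+ 2)%:E = (s ^+ 2)%:E)%E.
  rewrite integral_cst// -[RHS]mule1; congr (_ * _)%E; exact: probability_setT.
rewrite EFinD leeD2l//.
rewrite integral_nneseries//.
apply: lime_le; first by apply: is_cvg_nneseries => k _ _; apply: integral_ge0.
apply: nearW => n.
apply: (@le_trans _ _ (\sum_(0 <= k < n) (c k * p k)%:E)%E); last first.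
  by rewrite sumEFin lee_fin; exact: pB.
apply: lee_sum => k _; under eq_integral => w _ do rewrite EFinM.
have [mg g0 _ ig] := gP k.
rewrite ge0_integralZl//; last 3 first.
- exact/measurable_EFinP.
- by move=> w _; rewrite lee_fin.
- by rewrite lee_fin.
by rewrite (EFinM (c k) (p k)); apply: lee_wpmul2l; rewrite ?lee_fin.
Qed.

Lemma expR1_le (R : realType) : expR (1 : R) <= 29 / 10.
Proof.
have h : (9 / 10) ^+ 10 <= expR (- 1 : R).
  have -> : (- 1 : R) = 10%:R * (- (1 / 10)) by lra.
  rewrite expRM_natl; apply: lerXn2r; rewrite ?nnegrE ?expR_ge0//.
  by apply: le_trans (expR_ge1Dx _); lra.
have h2 : (10 / 29 : R) <= (9 / 10) ^+ 10 by lra.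
have := le_trans h2 h; rewrite expRN => h3.
have e0 := expR_gt0 (1 : R).
have : expR 1 * (10 / 29) <= expR 1 * (expR 1)^-1 :> R by rewrite ler_wpM2l// ltW.
by rewrite divff ?gt_eqF//; lra.
Qed.

(** Seven squarings starting from 129/128 <= exp(1/128), each rounded down to a short decimal. *)
Lemma expR1_ge (R : realType) : 27 / 10 <= expR (1 : R).
Proof.
have step (t x y : R) : 0 <= x -> y <= x ^+ 2 -> x <= expR t -> y <= expR (2 * t).
  move=> x0 yx xe; apply: (le_trans yx).
  by rewrite (expRM_natl 2 t) lerXn2r// nnegrE expR_ge0.
have h : 129 / 128 <= expR (1 / 128 : R).
  by apply: le_trans (expR_ge1Dx _); lra.
have {}h := @step _ (129 / 128) (1 + 15 / 1000 + 68 / 100 / 1000)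
  ltac:(clear; lra) ltac:(clear; lra) h.
have {}h := @step _ (1 + 15 / 1000 + 68 / 100 / 1000) (1 + 31 / 1000 + 60 / 100 / 1000)
  ltac:(clear; lra) ltac:(clear; lra) h.
have {}h := @step _ (1 + 31 / 1000 + 60 / 100 / 1000) (1 + 64 / 1000 + 19 / 100 / 1000)
  ltac:(clear; lra) ltac:(clear; lra) h.
have {}h := @step _ (1 + 64 / 1000 + 19 / 100 / 1000) (1 + 132 / 1000 + 50 / 100 / 1000)
  ltac:(clear; lra) ltac:(clear; lra) h.
have {}h := @step _ (1 + 132 / 1000 + 50 / 100 / 1000) (1 + 282 / 1000 + 55 / 100 / 1000)
  ltac:(clear; lra) ltac:(clear; lra) h.
have {}h := @step _ (1 + 282 / 1000 + 55 / 100 / 1000) (1 + 644 / 1000 + 93 / 100 / 1000)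
  ltac:(clear; lra) ltac:(clear; lra) h.
have {}h := @step _ (1 + 644 / 1000 + 93 / 100 / 1000) (2 + 705 / 1000 + 79 / 100 / 1000)
  ltac:(clear; lra) ltac:(clear; lra) h.
apply: (@le_trans _ _ (2 + 705 / 1000 + 79 / 100 / 1000)); first by clear; lra.
by apply: (le_trans h); clear; rewrite ler_expR; lra.
Qed.

(** The nonzero terms start at a value at most 1 and halve. The invariant [inv] keeps the remaining
    tail of the geometric series in reserve. *)
Lemma sum_inv_dyadic (R : realType) (y Y : R) n : 0 < y -> 0 < Y ->
  \sum_(0 <= k < n) (if Y <= 2 ^+ k * y then Y / (2 ^+ k * y) else 0) <= 2.
Proof.
move=> y0 Y0; have yk k : 0 < 2 ^+ k * y by rewrite mulr_gt0// exprn_gt0.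
have inv m : \sum_(0 <= k < m) (if Y <= 2 ^+ k * y then Y / (2 ^+ k * y) else 0)
    <= (if Y <= 2 ^+ m * y then 2 - 2 * (Y / (2 ^+ m * y)) else 0).
  elim: m => [|m IH].
    rewrite big_nil expr0 mul1r; case: ifPn => // h.
    have : Y / y <= 1 by rewrite ler_pdivrMr// mul1r.
    by lra.
  rewrite big_nat_recr//= exprS -mulrA.
  set z := 2 ^+ m * y in IH *; have z0 : 0 < z by exact: yk.
  have -> : Y / (2 * z) = Y / z / 2 by field; rewrite gt_eqF.
  have Yz0 : 0 < Y / z by rewrite divr_gt0.
  have [h|h] := leP Y z.
    rewrite h in IH; rewrite ifT; last lra.
    by apply: (le_trans (lerD IH (lexx _))); lra.
  have hn : (Y <= z) = false by rewrite leNgt h.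
  rewrite hn in IH; rewrite addr0; apply: (le_trans IH).
  case: ifPn => // h2.
  have : Y / z <= 2 by rewrite ler_pdivrMr//.
  lra.
apply: (le_trans (inv n)); case: ifPn => // h.
have : 0 < Y / (2 ^+ n * y) by rewrite divr_gt0.
lra.
Qed.

(** As r >= 16, 2 r + 3 <= 35/16 r, and d of the d + m + 2 small factors cancel r^d, leaving 35/16 *
    288/65 = 126/13. The remaining 64 r = 64 y q uses up one more. Of the last m + 1 factors, m are
    frozen at Y, and one is kept as (288/65 / Y) (Y / y) to be summed over dyadic y. *)
Lemma far_level_le (R : realType) (q y Y e : R) (d m : nat) :
  1 <= q -> 16 <= y -> 0 < Y <= y -> 0 <= e ->
  let r := y * q in
  4 * r ^+ 2 * (16 / r * (e * (2 * r + 3)) ^+ d * (288 / 65 * q / r) ^+ (d + m.+2))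
  <= 64 * (288 / 65) * q * (e * (126 / 13) * q) ^+ d * (288 / 65 / Y) ^+ m.+1 * (Y / y).
Proof.
move=> q1 y16 /andP[Y0 Yy] e0 /=; set r := y * q.
have q0 : 0 < q by lra.
have y0 : 0 < y by lra.
have r16 : 16 <= r by rewrite /r; nra.
set kp : R := 288 / 65; have kp0 : 0 < kp by rewrite /kp; lra.
have -> : kp * q / r = kp / y by rewrite /r; field; rewrite !gt_eqF.
have kY : 0 <= kp / Y by rewrite divr_ge0// ltW.
have ky : 0 <= kp / y by rewrite divr_ge0// ltW.
have h1 : (e * (2 * r + 3)) ^+ d <= (e * (35 / 16) * r) ^+ d.
  have h0 : 0 <= e * (2 * r + 3) by rewrite mulr_ge0//; lra.
  rewrite lerXn2r ?nnegrE//; last by rewrite -mulrA ler_wpM2l//; lra.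
  by rewrite mulr_ge0 ?mulr_ge0//; lra.
have h2 : (e * (35 / 16) * r) ^+ d * (kp / y) ^+ d = (e * (126 / 13) * q) ^+ d.
  by rewrite -exprMn /kp /r; congr (_ ^+ d); field; rewrite gt_eqF.
have h3 : (kp / y) ^+ m <= (kp / Y) ^+ m.
  by rewrite lerXn2r ?nnegrE// ler_wpM2l ?(ltW kp0)// lef_pV2 ?posrE.
set E := (e * (126 / 13) * q) ^+ d in h2 *.
have E0 : 0 <= E by rewrite exprn_ge0// !mulr_ge0 ?(ltW q0)//; lra.
apply: (@le_trans _ _ (64 * r * E * (kp / y) ^+ m.+2)).
  rewrite exprD -h2.
  have -> : 4 * r ^+ 2 * (16 / r * (e * (2 * r + 3)) ^+ d * ((kp / y) ^+ d * (kp / y) ^+ m.+2)) =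
    64 * r * ((e * (2 * r + 3)) ^+ d * ((kp / y) ^+ d)) * (kp / y) ^+ m.+2.
    by field; rewrite gt_eqF//; lra.
  rewrite ler_wpM2r ?exprn_ge0// ler_wpM2l//; first by rewrite mulr_ge0//; lra.
  by rewrite ler_wpM2r ?exprn_ge0.
have -> : 64 * r * E * (kp / y) ^+ m.+2 = 64 * kp * q * E * ((kp / y) * (kp / y) ^+ m).
  by rewrite !exprS /r; field; rewrite gt_eqF.
have -> : 64 * kp * q * E * (kp / Y) ^+ m.+1 * (Y / y) = 64 * kp * q * E * ((kp / y) * (kp / Y) ^+ m).
  by rewrite exprS; field; rewrite !gt_eqF.
apply: ler_wpM2l; last by apply: ler_wpM2l; [exact: ky|exact: h3].
apply: mulr_ge0 => //; apply: mulr_ge0; last exact: ltW.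
by apply: mulr_ge0; [clear; lra|exact: ltW].
Qed.

(** Here 957/1000 lies just below sqrt (11/12), and 32 q is sqrt (1024 d) in the application. The
    d-th powers compare with the factor 92/100 to spare, and the margin is thin: 128 * 288/65 *
    92/100 * 476/10000 is about 24.84, against 26 * 957/1000 = 24.88. *)
Lemma far_const_le (R : realType) (q Y e : R) (d m : nat) :
  (0 < d)%N -> 1 <= q -> 16 <= Y -> 500 * d%:R <= Y * (d + m + 4)%:R ->
  0 <= e <= 29 / 10 ->
  128 * (288 / 65) * q * (e * (126 / 13) * q) ^+ d * (288 / 65 / Y) ^+ m.+1
  <= 26 * d%:R * q * (957 / 1000) ^+ (d + m.+2) * (32 * q) ^+ d.
Proof.
move=> d0 q1 Y16 Yd /andP[e0 e29].
have d1 : 1 <= d%:R :> R by rewrite ler1n.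
have q0 : 0 < q by lra.
have Y0 : 0 < Y by lra.
set la : R := 957 / 1000; have laE : la = 957 / 1000 by [].
have la0 : 0 < la by rewrite laE; clear; lra.
set kp : R := 288 / 65; have kpE : kp = 288 / 65 by [].
have kp0 : 0 < kp by rewrite kpE; clear; lra.
clearbody la kp.
pose z := kp / la / Y; have zE : z = kp / la / Y by [].
have z0 : 0 <= z by apply: divr_ge0; [apply: divr_ge0|]; exact: ltW.
have kla : kp / la <= 463 / 100 by rewrite ler_pdivrMr// kpE laE; clear; lra.
have zY : z * Y <= 463 / 100 by rewrite /z divfK ?gt_eqF.
clearbody z.
(* For m = 0 and m = 1 the hypothesis on Y (d + m + 4) with d >= 1 gives Y >= 100 and Y >= 83; from
   m = 2 on, Y >= 16 and a third power suffice. *)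
have zm : z ^+ m.+1 <= 476 / 10000.
  case: m Yd => [|[|m]] Yd.
  - rewrite expr1; rewrite addn0 natrD in Yd; nra.
  - rewrite !natrD in Yd.
    have Y83 : 83 <= Y by nra.
    have z1 : z <= 56 / 1000 by nra.
    by nra.
  - have z1 : z <= 29 / 100 by nra.
    apply: (@le_trans _ _ (z ^+ 3)); first by rewrite ler_wiXn2l//; lra.
    apply: (@le_trans _ _ ((29 / 100) ^+ 3)); last by clear; lra.
    by rewrite lerXn2r ?nnegrE//; lra.
have h1 : (e * (126 / 13) * q) ^+ d <= 92 / 100 * (la ^+ d * (32 * q) ^+ d).
  have [mu muE] : exists mu : R, mu = 92 / 100 by exists (92 / 100).
  have mu0 : 0 <= mu by rewrite muE; clear; lra.
  have mu1 : mu <= 1 by rewrite muE; clear; lra.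
  have c0 : 0 <= e * (126 / 13) by apply: mulr_ge0 => //; clear; lra.
  have c1 : e * (126 / 13) <= mu * la * 32 by rewrite muE laE; move: e29; clear; lra.
  apply: (@le_trans _ _ ((mu * (la * (32 * q))) ^+ d)).
    have -> : mu * (la * (32 * q)) = mu * la * 32 * q by ring.
    by apply: lerXn2r; rewrite ?nnegrE ?mulr_ge0 ?(ltW la0) ?(ltW q0)// ler_wpM2r// ltW.
  rewrite -muE [in leLHS]exprMn [in leLHS]exprMn ler_wpM2r//.
    by rewrite mulr_ge0// exprn_ge0 ?mulr_ge0// ltW.
  case: d d0 {Yd d1} => // d _; rewrite exprS ler_piMr//.
  by rewrite exprn_ile1.
have kz : (kp / Y) ^+ m.+1 = la ^+ m.+1 * z ^+ m.+1.
  by rewrite -exprMn zE; congr (_ ^+ _); field; rewrite !gt_eqF.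
set W := la ^+ d * (32 * q) ^+ d in h1.
have W0 : 0 <= W by rewrite mulr_ge0 ?exprn_ge0 ?mulr_ge0 ?ltW.
apply: (@le_trans _ _ (128 * kp * q * (92 / 100 * W) * (la ^+ m.+1 * (476 / 10000)))).
  rewrite kz; apply: ler_pM.
  - by rewrite !mulr_ge0 ?exprn_ge0 ?mulr_ge0 ?(ltW q0) ?(ltW kp0) ?(ltW la0).
  - by rewrite mulr_ge0 ?exprn_ge0 ?(ltW la0).
  - by apply: ler_wpM2l => //; rewrite !mulr_ge0 ?(ltW q0) ?(ltW kp0).
  - by apply: ler_wpM2l => //; rewrite exprn_ge0 ?(ltW la0).
have -> : 26 * d%:R * q * la ^+ (d + m.+2) * (32 * q) ^+ d =
    26 * d%:R * la * (q * W * la ^+ m.+1).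
  by rewrite exprD (exprS la m.+1) /W; ring.
have -> : 128 * kp * q * (92 / 100 * W) * (la ^+ m.+1 * (476 / 10000)) =
    128 * kp * (92 / 100) * (476 / 10000) * (q * W * la ^+ m.+1) by ring.
have s0 : 0 <= q * W * la ^+ m.+1.
  by apply: mulr_ge0; [apply: mulr_ge0 => //; exact: ltW|apply: exprn_ge0; exact: ltW].
apply: ler_wpM2r; first exact: s0.
by rewrite kpE laE; move: d1; clear; lra.
Qed.

Lemma succ_le_exp2 (R : realType) k : k%:R + 1 <= (2 : R) ^+ k.
Proof. by rewrite natr1 -natrX ler_nat ltn_expl. Qed.

Lemma bulk_const_le (R : realType) (d : nat) :
  (expR 1 * 515) ^+ d <= expR (8 * d%:R) :> R.
Proof.
rewrite expRM_natr; apply: lerXn2r.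
- by rewrite nnegrE; apply: mulr_ge0; [exact: expR_ge0|exact: ler0n].
- by rewrite nnegrE; exact: expR_ge0.
have e1 := expR1_ge R; set e := expR 1 in e1 *.
have -> : expR 8 = e * e ^+ 7 :> R by rewrite -exprS -expRM_natl mulr1.
have e3 : 19 <= e ^+ 3 by rewrite !exprS expr0 mulr1; nra.
have e7 : 515 <= e ^+ 7.
  rewrite (_ : e ^+ 7 = e ^+ 3 * e ^+ 3 * e); last by ring.
  move: (e ^+ 3) e3 => c e3.
  have : 361 <= c * c by nra.
  nra.
by rewrite ler_wpM2l//; lra.
Qed.

Lemma expR_decay_le (R : realType) k :
  4 * (2 ^+ k) ^+ 2 * expR (- (16 / 5 + 56 / 5 * k%:R)) <= 18 / 100 * (1 / 10) ^+ k :> R.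
Proof.
have e1 := expR1_ge R; set e := expR 1 in e1.
have e32 : 200 / 9 <= expR (16 / 5) :> R.
  have -> : (16 / 5 : R) = 3%:R * 1 + 1 / 5 by lra.
  rewrite expRD expRM_natl -/e.
  have e3 : 19683 / 1000 <= e ^+ 3.
    have -> : 19683 / 1000 = (27 / 10) ^+ 3 :> R by lra.
    by rewrite lerXn2r ?nnegrE//; lra.
  have := expR_ge1Dx (1 / 5 : R); nra.
have e112 : 40 <= expR (56 / 5) :> R.
  apply: (@le_trans _ _ (expR (4%:R * 1))); last by rewrite ler_expR; lra.
  rewrite expRM_natl -/e (_ : e ^+ 4 = (e * e) * (e * e)); last by ring.
  have : 7 <= e * e by nra.
  nra.
rewrite opprD expRD -(mulNr (56 / 5)) expRM_natr.
have E1 : expR (- (16 / 5)) <= 9 / 200 :> R.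
  by rewrite expRN -[leRHS]invrK lef_pV2 ?posrE ?expR_gt0//; lra.
have E2 : expR (- (56 / 5)) <= 1 / 40 :> R.
  by rewrite expRN -[leRHS]invrK lef_pV2 ?posrE ?expR_gt0//; lra.
have E1p : 0 <= expR (- (16 / 5)) :> R by exact: expR_ge0.
have E2p : 0 <= expR (- (56 / 5)) :> R by exact: expR_ge0.
move: (expR (- (16 / 5))) (expR (- (56 / 5))) E1 E2 E1p E2p => a b a1 b1 a0 b0.
have -> : 4 * (2 ^+ k) ^+ 2 * (a * b ^+ k) = 4 * a * (4 * b) ^+ k.
  by rewrite exprMn -exprM mulnC exprM (_ : 2 ^+ 2 = 4 :> R); ring.
apply: ler_pM; first by rewrite mulr_ge0.
- by rewrite exprn_ge0// mulr_ge0.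
- by lra.
- by rewrite lerXn2r ?nnegrE ?mulr_ge0//; lra.
Qed.

Lemma bulk_level_le (R : realType) (d N k : nat) (y : R) :
  (0 < d)%N -> y = 500 * d%:R / (N + 2)%:R -> 2 ^+ k * y <= 16 ->
  4 * (2 ^+ k) ^+ 2 * ((expR 1 * 515) ^+ d * (1 - 48 / 125 * (2 ^+ k * y / 16)) ^+ N)
  <= 18 / 100 * (1 / 10) ^+ k.
Proof.
move=> d0 yE yk.
have d1 : 1 <= d%:R :> R by rewrite ler1n.
have N0 : 0 < (N + 2)%:R :> R by rewrite ltr0n addn2.
have y0 : 0 < y by rewrite yE; apply: divr_gt0; [lra|exact: N0].
have k1 := @succ_le_exp2 R k; have k0 := ler0n R k.
have K1 : 1 <= 2 ^+ k :> R by lra.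
have y16 : y <= 16 by apply: le_trans yk; rewrite ler_peMl// ltW.
have Ny : 500 * d%:R <= 16 * (N + 2)%:R :> R.
  by move: y16; rewrite {1}yE (ler_pdivrMr _ _ N0).
set x := 48 / 125 * _.
have x1 : x <= 1 by rewrite /x; lra.
have xN : 56 / 5 * (1 + k%:R) * d%:R <= x * N%:R.
  have -> : x * N%:R = 2 ^+ k * (12 * d%:R * N%:R / (N + 2)%:R).
    by rewrite /x yE; field; rewrite gt_eqF.
  (* The claim amounts to N >= 28, which follows from 16 (N + 2) >= 500 d >= 500. *)
  have h : 56 / 5 * d%:R <= 12 * d%:R * N%:R / (N + 2)%:R :> R.
    by rewrite ler_pdivlMr//; rewrite natrD in Ny *; nra.
  have h' : 2 ^+ k * (56 / 5 * d%:R) <= 2 ^+ k * (12 * d%:R * N%:R / (N + 2)%:R) :> R.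
    by rewrite ler_wpM2l//; lra.
  apply: le_trans h'.
  have : (1 + k%:R) * (56 / 5 * d%:R) <= 2 ^+ k * (56 / 5 * d%:R) :> R.
    by rewrite ler_wpM2r//; lra.
  lra.
have pN : (1 - x) ^+ N <= expR (- (x * N%:R)).
  rewrite -(mulNr x) expRM_natr; apply: lerXn2r; rewrite ?nnegrE.
  - lra.
  - exact: expR_ge0.
  - exact: expR_ge1Dx.
apply: le_trans (expR_decay_le R k).
rewrite ler_wpM2l ?mulr_ge0 ?sqr_ge0//.
apply: (@le_trans _ _ (expR (8 * d%:R) * expR (- (x * N%:R)))).
  apply: ler_pM.
  - by apply: exprn_ge0; apply: mulr_ge0; [exact: expR_ge0|exact: ler0n].
  - by apply: exprn_ge0; lra.
  - exact: bulk_const_le.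
  - exact: pN.
rewrite -expRD ler_expR.
have : 0 <= k%:R * d%:R - k%:R :> R by nra.
lra.
Qed.

Lemma sum_geometric_tenth (R : realType) n :
  \sum_(0 <= k < n) (1 / 10) ^+ k <= 10 / 9 :> R.
Proof.
rewrite big_mkord; apply: le_trans (sum_geometric_le n _) _; first by lra.
have -> : (1 - 1 / 10 : R) = 9 / 10 by lra.
by rewrite invf_div.
Qed.

Lemma EW2_le_aux (R : realType) dsp (T : measurableType dsp)
    (P : probability T R) d m (delta : R) (phi : 'I_(d + m.+2) -> T -> 'rV[R]_d)
    (eps : 'I_(d + m.+2) -> T -> R) :
  (0 < d)%N -> 0 < delta -> model P delta phi eps ->
  let q := Num.sqrt d%:R in
  is_true (EW2 P delta phi eps <=
    (6 / 5 * (500 * d%:R / (d + m.+2 + 2)%:R * q * delta) ^+ 2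
     + delta ^+ 2 * (26 * d%:R * q * (957 / 1000) ^+ (d + m.+2) * (32 * q) ^+ d))%:E)%E.
Proof.
have NE : forall a b, (a + b + 4 = a + b.+2 + 2)%N by clear; lia.
move=> d0 del0 mod q; pose N := (d + m.+2)%N.
have d1 : 1 <= d%:R :> R by rewrite ler1n.
have q1 : 1 <= q by rewrite -[leLHS]sqrtr1 ler_wsqrtr.
have q0 : 0 < q by lra.
have N0 : 0 < (N + 2)%:R :> R by rewrite ltr0n addn2.
pose y : R := 500 * d%:R / (N + 2)%:R.
have y0 : 0 < y by apply: divr_gt0; [lra|exact: N0].
pose yk (k : nat) : R := 2 ^+ k * y.
have yk0 k : 0 < yk k by apply: mulr_gt0 => //; exact: exprn_gt0.
have y_le k : y <= yk k.
  by rewrite /yk ler_peMl ?(ltW y0)// exprn_ege1// ler1n.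
pose e : R := expR 1.
have e29 : 0 <= e <= 29 / 10 by rewrite expR_ge0 expR1_le.
pose bulkp k : R := (e * 515) ^+ d * (1 - 48 / 125 * (yk k / 16)) ^+ N.
pose farp k : R := let r := yk k * q in
  16 / r * (e * (2 * r + 3)) ^+ d * (288 / 65 * q / r) ^+ N.
pose p k := if yk k <= 16 then bulkp k else farp k.
pose s := y * q * delta.
have s0 : 0 < s by apply: mulr_gt0 => //; exact: mulr_gt0.
(* Lower bound for all levels of the second regime: they exceed 16, and no level is below [y]. If N
   is so small that y > 16, the first regime is empty. *)
pose Y := Num.max 16 y.
have Y16 : 16 <= Y by rewrite le_max lexx.
have Yy : y <= Y by rewrite le_max lexx orbT.
have Y0 : 0 < Y by lra.
pose D : R := 64 * (288 / 65) * q * (e * (126 / 13) * q) ^+ d * (288 / 65 / Y) ^+ m.+1.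
have D0 : 0 <= D.
  have [e0 _] := andP e29.
  have c1 : 0 <= 64 * (288 / 65) * q by lra.
  have c2 : 0 <= e * (126 / 13) * q.
    by apply: mulr_ge0; [apply: mulr_ge0 => //; lra|exact: ltW].
  have c3 : 0 <= 288 / 65 / Y by apply: divr_ge0; [clear; lra|exact: ltW].
  by apply: mulr_ge0; [apply: mulr_ge0 => //; exact: exprn_ge0|exact: exprn_ge0].
have far_const : 2 * D <= 26 * d%:R * q * (957 / 1000) ^+ (d + m.+2) * (32 * q) ^+ d.
  have Yd : 500 * d%:R <= Y * (d + m + 4)%:R.
    have -> : (d + m + 4 = N + 2)%N by exact: NE.
    have : y * (N + 2)%:R <= Y * (N + 2)%:R by rewrite ler_wpM2r// ltW.
    by apply: le_trans; rewrite /y divfK ?gt_eqF.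
  have := far_const_le d0 q1 Y16 Yd e29; apply: le_trans.
  by rewrite le_eqVlt; apply/orP; left; apply/eqP; rewrite /D; ring.
have level k : 4 * (2 ^+ k * s) ^+ 2 * p k <=
    s ^+ 2 * (18 / 100 * (1 / 10) ^+ k) +
    delta ^+ 2 * D * (if Y <= 2 ^+ k * y then Y / (2 ^+ k * y) else 0).
  have t0 : 0 <= s ^+ 2 * (18 / 100 * (1 / 10) ^+ k).
    by apply: mulr_ge0; [exact: sqr_ge0|apply: mulr_ge0; [clear; lra|apply: exprn_ge0; clear; lra]].
  have t1 : 0 <= delta ^+ 2 * D * (if Y <= 2 ^+ k * y then Y / (2 ^+ k * y) else 0).
    apply: mulr_ge0; first by apply: mulr_ge0 => //; exact: sqr_ge0.
    by case: ifPn => // _; apply: divr_ge0; apply: ltW => //; exact: yk0.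
  rewrite /p; have [k16|k16] := leP (yk k) 16.
    apply: ler_wpDr => //.
    have := @bulk_level_le R d N k y d0 erefl k16; rewrite -/e -/(yk k) -/(bulkp k) => h.
    have -> : 4 * (2 ^+ k * s) ^+ 2 * bulkp k = s ^+ 2 * (4 * (2 ^+ k) ^+ 2 * bulkp k) by ring.
    by apply: ler_wpM2l => //; exact: sqr_ge0.
  apply: ler_wpDl => //.
  have Yk : Y <= yk k by rewrite ge_max y_le andbT ltW.
  rewrite -/(yk k) Yk.
  have h := @far_level_le R q (yk k) Y e d m q1 (ltW k16) _ (andP e29).1.
  have {}h := h (introT andP (conj Y0 Yk)).
  have -> : 4 * (2 ^+ k * s) ^+ 2 * farp k = delta ^+ 2 * (4 * (yk k * q) ^+ 2 * farp k).
    by rewrite /s /yk; ring.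
  by rewrite -[leRHS]mulrA; apply: ler_wpM2l; [exact: sqr_ge0|exact: h].
(* The 1/5 is 18/100 * 10/9 from the first regime, and the 2 in [2 * D] comes from
   [sum_inv_dyadic]. *)
apply: le_trans (_ : (_ <= (s ^+ 2 + (s ^+ 2 * (1 / 5) + delta ^+ 2 * (2 * D)))%:E)%E) _; last first.
  rewrite lee_fin addrA; apply: lerD.
    have h6 : s ^+ 2 + s ^+ 2 * (1 / 5) <= 6 / 5 * s ^+ 2 by move: (s ^+ 2) => t; lra.
    exact: h6.
  by apply: ler_wpM2l => //; exact: sqr_ge0.
apply: (layer_cake (p := p)) => //.
- move=> k; rewrite /p; case: ifPn => [k16|].
    have a01 : 0 < yk k / 16 <= 1.
      by apply/andP; split; [apply: divr_gt0 => //; exact: yk0|lra].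
    have sE : 16 * (yk k / 16) * q * delta = 2 ^+ k * s by rewrite /yk /s; field.
    by have := bulk_tail_bound mod d0 del0 a01; rewrite -/q sE.
  rewrite -ltNge => k16.
  have rq : 16 * Num.sqrt d%:R <= yk k * q by rewrite ler_wpM2r// ltW.
  have sE : yk k * q * delta = 2 ^+ k * s by rewrite /yk /s; ring.
  by have := far_tail_bound mod d0 del0 rq; rewrite -/q sE.
- move=> n; apply: (@le_trans _ _ (\sum_(0 <= k < n)
    (s ^+ 2 * (18 / 100 * (1 / 10) ^+ k) +
    delta ^+ 2 * D * (if Y <= 2 ^+ k * y then Y / (2 ^+ k * y) else 0)))).
    by apply: ler_sum => k _; exact: level.
  rewrite big_split /= -!mulr_sumr; apply: lerD.
    apply: ler_wpM2l; first exact: sqr_ge0.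
    by have := @sum_geometric_tenth R n; lra.
  rewrite -mulrA; apply: ler_wpM2l; first exact: sqr_ge0.
  rewrite mulrC; apply: ler_wpM2r => //.
  exact: sum_inv_dyadic.
Qed.

Lemma expR12_ge (R : realType) : 3 / 5 * (500 * 500) <= expR 12 :> R.
Proof.
have e1 := expR1_ge R; rewrite -[X in expR X]mulr1 expRM_natl.
move: (expR 1) e1 => e e1.
have -> : e ^+ 12 = (e ^+ 3 * e ^+ 3) * (e ^+ 3 * e ^+ 3) by ring.
have e3 : 19 + 683 / 1000 <= e ^+ 3.
  have -> : 19 + 683 / 1000 = (27 / 10) ^+ 3 :> R by lra.
  by apply: lerXn2r; rewrite ?nnegrE; lra.
move: (e ^+ 3) e3 => c c1.
have c2 : 387 + 4 / 10 <= c * c by nra.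
move: (c * c) c2 => b b1; nra.
Qed.

Lemma sqrt_scale_expn (R : realType) (d : nat) : (0 < d)%N ->
  (32 * Num.sqrt d%:R) ^+ d = expR (d%:R * ln (1024 * d%:R) / 2) :> R.
Proof.
move=> d0; have q0 : 0 < Num.sqrt (d%:R : R) by rewrite sqrtr_gt0 ltr0n.
set q := Num.sqrt _ in q0 *.
have q32 : 0 < 32 * q by lra.
have -> : 1024 * d%:R = (32 * q) ^+ 2 by rewrite exprMn sqr_sqrtr//; ring.
rewrite lnXn// -mulrA expRM_natl; congr (_ ^+ d).
have -> : ln (32 * q) *+ 2 / 2 = ln (32 * q).
  by rewrite mulr2n; move: (ln _) => t; lra.
by rewrite lnK.
Qed.

Lemma powR_three_halves (R : realType) (d : nat) :
  (d%:R : R) `^ (3 / 2) = d%:R * Num.sqrt d%:R.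
Proof.
have -> : (3 / 2 : R) = 1 + 2^-1 by lra.
rewrite powRD; last by apply/implyP => /eqP; lra.
by rewrite powRr1// powR12_sqrt.
Qed.

Lemma powR_eleven_twelfths (R : realType) (N : nat) :
  (957 / 1000) ^+ N <= (11 / 12) `^ (N%:R / 2) :> R.
Proof.
have a0 : 0 <= 11 / 12 :> R by lra.
rewrite (mulrC N%:R) powRrM powR12_sqrt// powR_mulrn ?sqrtr_ge0//.
have b0 : 0 <= 957 / 1000 :> R by clear; lra.
apply: lerXn2r.
- by rewrite nnegrE.
- by rewrite nnegrE; exact: sqrtr_ge0.
- rewrite -[X in X <= _](ger0_norm b0) -sqrtr_sqr; apply: ler_wsqrtr.
  by clear; lra.
Qed.

Lemma EW2_bound (R : realType) dsp (T : measurableType dsp)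
    (P : probability T R) (d N : nat) (delta : R) (phi : 'I_N -> T -> 'rV[R]_d)
    (eps : 'I_N -> T -> R) :
  (1 <= d)%N -> 0 < delta -> (d + 2 <= N)%N -> model P delta phi eps ->
  (EW2 P delta phi eps <=
       ((2 * expR 12 * delta ^+ 2 * d%:R ^+ 3 / (N.+1%:R * N.+2%:R)
        + 26 * delta ^+ 2 * (d%:R `^ (3 / 2)) * ((11 / 12) `^ (N%:R / 2))
          * expR (d%:R * ln (1024 * d%:R) / 2))%:E))%E.
Proof.
move=> d0 del0 dN.
have [m NE] : exists m, N = (d + m.+2)%N.
  by exists (N - d - 2)%N; rewrite -(subnK dN); lia.
subst N => mod; apply: (le_trans (EW2_le_aux d0 del0 mod)).
rewrite lee_fin; set N := (d + m.+2)%N; set q := Num.sqrt d%:R.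
have q2 : q ^+ 2 = d%:R by rewrite sqr_sqrtr.
have q0 : 0 <= q by exact: sqrtr_ge0.
apply: lerD.
  have -> : (N + 2)%:R = N.+2%:R :> R by rewrite addn2.
  have n1 : 0 < N.+1%:R :> R by [].
  have n2 : 0 < N.+2%:R :> R by [].
  have n12 : N.+1%:R <= N.+2%:R :> R by rewrite ler_nat.
  move: (N.+1%:R) (N.+2%:R) n1 n2 n12 => a b a0 b0 ab.
  have -> : 6 / 5 * (500 * d%:R / b * q * delta) ^+ 2 =
     2 * (3 / 5 * (500 * 500)) * (delta ^+ 2 * d%:R ^+ 3) * (b * b)^-1.
    have -> : 6 / 5 * (500 * d%:R / b * q * delta) ^+ 2 =
      6 / 5 * (500 * d%:R / b * delta) ^+ 2 * q ^+ 2 by ring.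
    by rewrite q2; field; rewrite gt_eqF.
  have D0 : 0 <= delta ^+ 2 * d%:R ^+ 3 :> R.
    by apply: mulr_ge0; [exact: sqr_ge0|exact: exprn_ge0].
  rewrite -[leRHS]/(2 * expR 12 * delta ^+ 2 * d%:R ^+ 3 * (a * b)^-1).
  rewrite -(mulrA (2 * expR 12)).
  have ab0 : 0 < a * b by exact: mulr_gt0.
  have bb0 : 0 < b * b by exact: mulr_gt0.
  apply: ler_pM.
  - by apply: mulr_ge0; [lra|exact: D0].
  - by rewrite invr_ge0 ltW.
  - by apply: ler_wpM2r => //; have := expR12_ge R; lra.
  - by rewrite lef_pV2 ?posrE//; apply: ler_wpM2r => //; exact: ltW.
rewrite powR_three_halves -/q -sqrt_scale_expn// -/q.
have h := powR_eleven_twelfths R N.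
have -> : delta ^+ 2 * (26 * d%:R * q * (957 / 1000) ^+ N * (32 * q) ^+ d) =
  26 * delta ^+ 2 * (d%:R * q) * (957 / 1000) ^+ N * (32 * q) ^+ d by ring.
apply: ler_wpM2r; first by apply: exprn_ge0; lra.
apply: ler_wpM2l => //; apply: mulr_ge0; last exact: mulr_ge0.
by apply: mulr_ge0; [lra|exact: sqr_ge0].
Qed.

(** * Asymptotics in the dimension *)

(** With q = sqrt d the decay is at least exp(-q^3 / 24), since N >= q^3 and 11/12 <= exp(-1/12).
    The growth is only (32 q)^(q^2), that is, exp of q^2 (C + ln (q / 200)) <= C q^2 + q^3 / 200.
    The prefactor q^3 costs exp(q^3 / 48), and a large q absorbs C q^2 and leaves exp(-d). *)
Lemma second_term_le (R : realType) : exists K : R, forall d N : nat,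
  (0 < d)%N -> K <= d%:R -> d%:R `^ (3 / 2) <= N%:R :> R ->
  d%:R `^ (3 / 2) * ((11 / 12) `^ (N%:R / 2)) * expR (d%:R * ln (1024 * d%:R) / 2)
   <= 48 * expR (- d%:R) :> R.
Proof.
pose C : R := ln (32 * 200); pose K : R := 100 * (`|C| + 1).
exists (K ^+ 2) => d N d0 Kd XN.
set q := Num.sqrt (d%:R : R).
have q2 : q ^+ 2 = d%:R by rewrite sqr_sqrtr.
have q0 : 0 < q by rewrite sqrtr_gt0 ltr0n.
have K0 : 0 <= K by rewrite mulr_ge0// addr_ge0.
have Kq : K <= q by rewrite -(ler_pXn2r (n := 2)) ?nnegrE ?(ltW q0)// q2.
have X1 : d%:R `^ (3 / 2) = q ^+ 3 by rewrite powR_three_halves -/q -q2; ring.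
rewrite {}X1 in XN *.
have h1 : (11 / 12) `^ (N%:R / 2) <= expR (- (q ^+ 3 / 24)) :> R.
  apply: (@le_trans _ _ (expR (- (1 / 12)) `^ (N%:R / 2))).
    apply: ge0_ler_powR; rewrite ?nnegrE ?expR_ge0//.
    by apply: le_trans (expR_ge1Dx _); clear; lra.
  rewrite -expRM ler_expR; lra.
have h2 : expR (d%:R * ln (1024 * d%:R) / 2) <= expR (q ^+ 2 * C + q ^+ 3 / 200).
  rewrite -sqrt_scale_expn// -/q.
  have -> : 32 * q = expR (C + ln (q / 200)).
    rewrite expRD !lnK ?posrE; last 2 first.
    - by clear; lra.
    - by apply: divr_gt0; [exact: q0|clear; lra].
    by field.
  rewrite -expRM_natl ler_expR -q2 mulrDr lerD2l.
  have l1 : ln (q / 200) <= q / 200.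
    by apply/ltW/ln_sublinear/divr_gt0; [exact: q0|clear; lra].
  have -> : q ^+ 3 / 200 = q ^+ 2 * (q / 200) by rewrite exprSr mulrA.
  by apply: ler_wpM2l => //; exact: sqr_ge0.
have h3 : q ^+ 3 <= 48 * expR (q ^+ 3 / 48).
  have := expR_ge1Dx (q ^+ 3 / 48); lra.
have q30 : 0 <= q ^+ 3 by rewrite exprn_ge0// ltW.
apply: (@le_trans _ _ ((48 * expR (q ^+ 3 / 48)) * expR (- (q ^+ 3 / 24)) *
    expR (q ^+ 2 * C + q ^+ 3 / 200))).
  apply: ler_pM => //; first by rewrite mulr_ge0// powR_ge0.
  by apply: ler_pM => //; exact: powR_ge0.
rewrite -!mulrA ler_wpM2l// -!expRD ler_expR -q2.
have Cq : 100 * (C + 1) <= q by apply: le_trans Kq; rewrite /K; have := ler_norm C; lra.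
have : q ^+ 2 * (100 * (C + 1)) <= q ^+ 2 * q by apply: ler_wpM2l => //; exact: sqr_ge0.
rewrite -exprSr; have := q30; lra.
Qed.

(** The parameter [M] serves both asymptotic claims: 1 for the limsup, arbitrarily large for the
    limit 0. The threshold [K] is uniform in [M]. *)
Lemma EW2_eventually_le (R : realType) (delta e : R) : 0 < delta -> 0 < e ->
  exists K : R, forall dsp (T : measurableType dsp) (P : probability T R)
    (d N : nat) (M : R) (phi : 'I_N -> T -> 'rV[R]_d) (eps : 'I_N -> T -> R),
  K <= d%:R -> 1 <= M -> M * d%:R `^ (3 / 2) <= N%:R ->
  ((1 <= d)%N -> model P delta phi eps) ->
  (EW2 P delta phi eps <= (2 * expR 12 * delta ^+ 2 / M ^+ 2 + e)%:E)%E.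
Proof.
move=> del0 e0; have [K0 hK0] := second_term_le R.
pose c : R := 26 * delta ^+ 2 * 48.
have c0 : 0 < c.
  by apply: mulr_gt0 => //; apply: mulr_gt0 => //; exact: exprn_gt0.
(* From d >= 4 follows d sqrt d >= 2 d >= d + 2, as [EW2_bound] requires; c / e makes c exp(-d) <= e
   because d <= exp(d). *)
exists (Num.max K0 (Num.max 4 (c / e))) => dsp T P d N M phi eps.
rewrite !ge_max => /and3P[dK0 d4 dce] M1 MN mod.
have d4n : (4 <= d)%N by rewrite -(ler_nat R).
have d0 : (0 < d)%N by exact: leq_trans d4n.
set X := d%:R `^ (3 / 2) in MN *.
have q2 : Num.sqrt (d%:R : R) ^+ 2 = d%:R by rewrite sqr_sqrtr.
have XE : X = d%:R * Num.sqrt d%:R by exact: powR_three_halves.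
have q_ge2 : 2 <= Num.sqrt (d%:R : R).
  rewrite -(ler_pXn2r (n := 2)) ?nnegrE ?sqrtr_ge0// q2.
  by apply: le_trans d4; lra.
have X0 : 0 < X by rewrite XE; nra.
have XN : X <= N%:R by apply: le_trans MN; rewrite ler_peMl// ltW.
have dN : (d + 2 <= N)%N.
  by rewrite -(ler_nat R) natrD; apply: le_trans XN; rewrite XE; nra.
apply: (le_trans (EW2_bound d0 del0 dN (mod d0))).
rewrite lee_fin; apply: lerD.
  have d3 : (d%:R : R) ^+ 3 = X ^+ 2.
    by rewrite XE exprMn q2 -exprSr.
  rewrite d3 -mulrA; apply: ler_wpM2l.
    by apply: mulr_ge0; [rewrite mulr_ge0 ?expR_ge0|exact: sqr_ge0].
  have M0 : 0 < M by lra.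
  have M20 : 0 < M ^+ 2 by exact: exprn_gt0.
  have N0 : 0 <= N%:R :> R by [].
  rewrite ler_pdivrMr; last by apply: mulr_gt0.
  rewrite mulrC ler_pdivlMr// -!(natr1 N.+1) -!(natr1 N).
  have : (M * X) ^+ 2 <= N%:R ^+ 2 by rewrite lerXn2r ?nnegrE// mulr_ge0// ltW.
  move: (N%:R) N0 => n n0; rewrite exprMn => h.
  by apply: (le_trans _ (_ : n ^+ 2 <= _)); [rewrite mulrC|nra].
have h := hK0 d N d0 dK0 XN; rewrite -/X in h.
have -> : 26 * delta ^+ 2 * X * ((11 / 12) `^ (N%:R / 2)) *
    expR (d%:R * ln (1024 * d%:R) / 2) =
  26 * delta ^+ 2 * (X * ((11 / 12) `^ (N%:R / 2)) * expR (d%:R * ln (1024 * d%:R) / 2)).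
  by rewrite !mulrA.
apply: (@le_trans _ _ (26 * delta ^+ 2 * (48 * expR (- d%:R)))).
  by apply: ler_wpM2l => //; apply: mulr_ge0 => //; exact: sqr_ge0.
rewrite mulrA -/c expRN ler_pdivrMr ?expR_gt0//.
have : c <= e * d%:R by rewrite mulrC -ler_pdivrMr.
move=> /le_trans; apply; apply: ler_wpM2l; first exact: ltW.
by apply: le_trans (expR_ge1Dx _); rewrite lerDr.
Qed.

Lemma limn_esup_le (R : realType) (u : nat -> \bar R) (c : R) :
  (forall e : R, 0 < e -> exists K : R, forall n, K <= n%:R -> (u n <= (c + e)%:E)%E) ->
  (limn_esup u <= c%:E)%E.
Proof.
move=> h; apply/lee_addgt0Pr => e e0; have [K hK] := h e e0.
apply: (@le_trans _ _ (ereal_sup (u @` [set n | K <= n%:R]))).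
  apply: ereal_inf_lbound; exists [set n | K <= n%:R] => //=.
  exact: nbhs_infty_ger.
by apply: ge_ereal_sup => _ [n /= Kn <-]; rewrite -EFinD; exact: hK.
Qed.

Lemma abs_ceil_ge (R : realType) (x : R) : 0 <= x -> x <= (`|Num.ceil x|%N)%:R.
Proof.
move=> x0; have c0 : 0 <= Num.ceil x by rewrite ceil_ge0; lra.
have -> : (`|Num.ceil x|%N)%:R = (Num.ceil x)%:~R :> R.
  by rewrite -{2}(gez0_abs c0).
exact: ceil_ge.
Qed.

Lemma EW2_ge0 (R : realType) dsp (T : measurableType dsp)
    (P : probability T R) (d N : nat) (delta : R) (phi : 'I_N -> T -> 'rV[R]_d)
    (eps : 'I_N -> T -> R) : (0 <= EW2 P delta phi eps)%E.
Proof. by apply: integral_ge0 => w _; rewrite sqre_ge0. Qed.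

Unset Implicit Arguments.

Theorem theorem6p1 (R : realType) :
  (forall (dsp : measure_display) (T : measurableType dsp) (P : probability T R)
     (d N : nat) (delta : R) (phi : 'I_N -> T -> 'rV[R]_d) (eps : 'I_N -> T -> R),
     (1 <= d)%N -> 0 < delta -> (d + 2 <= N)%N ->
     model P delta phi eps ->
     (EW2 P delta phi eps <=
       ((2 * expR 12 * delta ^+ 2 * d%:R ^+ 3 / (N.+1%:R * N.+2%:R)
        + 26 * delta ^+ 2 * (d%:R `^ (3 / 2)) * ((11 / 12) `^ (N%:R / 2))
          * expR (d%:R * ln (1024 * d%:R) / 2))%:E))%E) /\
  (forall (delta : R) (dsp : nat -> measure_display)
     (T : forall d, measurableType (dsp d)) (P : forall d, probability (T d) R)
     (phi : forall d, 'I_`|Num.ceil (d%:R `^ (3 / 2) : R)| -> T d -> 'rV[R]_d)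
     (eps : forall d, 'I_`|Num.ceil (d%:R `^ (3 / 2) : R)| -> T d -> R),
     0 < delta ->
     (forall d, (1 <= d)%N -> model (P d) delta (phi d) (eps d)) ->
     (limn_esup (fun d => EW2 (P d) delta (phi d) (eps d))
        <= (2 * expR 12 * delta ^+ 2)%:E)%E) /\
  (forall (delta : R) (dsp : nat -> measure_display)
     (T : forall d, measurableType (dsp d)) (P : forall d, probability (T d) R)
     (phi : forall d, 'I_`|Num.ceil (d%:R `^ (3 / 2) * ln (d%:R : R))| -> T d -> 'rV[R]_d)
     (eps : forall d, 'I_`|Num.ceil (d%:R `^ (3 / 2) * ln (d%:R : R))| -> T d -> R),
     0 < delta ->
     (forall d, (1 <= d)%N -> model (P d) delta (phi d) (eps d)) ->
     (fun d => EW2 (P d) delta (phi d) (eps d)) @ \oo --> 0%E).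
Proof.
split; [|split].
- by move=> dsp T P d N delta phi eps d0 del0 dN; exact: EW2_bound.
- move=> delta dsp T P phi eps del0 mod; apply: limn_esup_le => e e0.
  have [K hK] := EW2_eventually_le del0 e0; exists K => d Kd.
  have := hK _ _ (P d) d _ 1 (phi d) (eps d) Kd (lexx _).
  rewrite mul1r expr1n divr1; apply; last exact: mod.
  by apply: abs_ceil_ge; exact: powR_ge0.
- move=> delta dsp T P phi eps del0 mod; apply: limn_esup_le_cvg; last first.
    by move=> d; exact: EW2_ge0.
  apply: limn_esup_le => e e0; rewrite add0r.
  have e20 : 0 < e / 2 by lra.
  have [K hK] := EW2_eventually_le del0 e20.
  set c := 2 * expR 12 * delta ^+ 2 in hK.
  have c0 : 0 <= c by apply: mulr_ge0; [rewrite mulr_ge0 ?expR_ge0|exact: sqr_ge0].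
  (* Chosen so that c <= (e / 2) M, hence c / M^2 <= e / 2; the logarithm in N exceeds [M] as soon
     as d >= exp(M). *)
  pose M : R := 1 + c / (e / 2).
  have M1 : 1 <= M by rewrite lerDl divr_ge0// ltW.
  exists (Num.max K (expR M)) => d; rewrite ge_max => /andP[Kd Md].
  have d0 : 0 < d%:R :> R by apply: lt_le_trans Md; exact: expR_gt0.
  have lnM : M <= ln d%:R by rewrite -ler_expR lnK.
  have X0 : 0 <= d%:R `^ (3 / 2) :> R by exact: powR_ge0.
  have ceilX : M * d%:R `^ (3 / 2) <= (`|Num.ceil (d%:R `^ (3 / 2) * ln (d%:R : R))|%N)%:R.
    apply: le_trans (abs_ceil_ge _); first by rewrite mulrC ler_wpM2l.
    by rewrite mulr_ge0//; lra.
  have := hK _ _ (P d) d _ M (phi d) (eps d) Kd M1 ceilX (mod d).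
  move=> /le_trans; apply; rewrite lee_fin.
  have M0 : 0 < M by lra.
  have cM : c / M ^+ 2 <= e / 2.
    rewrite ler_pdivrMr ?exprn_gt0//.
    have h1 : c <= e / 2 * M.
      have -> : e / 2 * M = e / 2 + c.
        by rewrite /M mulrDr mulr1 (mulrC (e / 2) (c / _)) divfK// gt_eqF.
      by rewrite lerDr ltW.
    apply: (le_trans h1); apply: ler_wpM2l; first exact: ltW.
    by rewrite expr2 ler_peMr// ltW.
  by apply: (le_trans (lerD cM (lexx _))); rewrite -splitr.
Qed.
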